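(* Let $\mathcal{C}$ be a closed monoidal category with countable colimits and $(P,Q)$ a pivotal pair in $\mathcal{C}$. Let $T$ and $\alpha$ be the endofunctor of $\mathcal{C}$ and natural transformation $Q\otimes T\otimes P\Rightarrow T$ constructed from $(P,Q)$ in the context, and let $F:\mathcal{C}\to\mathcal{C}(P,Q)$ be the functor $F(X)=(T(X),\sigma^T_X)$, $F(f)=T(f)$, where $\sigma^T=(P\otimes\alpha)(\mathrm{coev}\otimes T\otimes P):T\otimes P\Rightarrow P\otimes T$. Then $F$ is left adjoint to the forgetful functor $U:\mathcal{C}(P,Q)\to\mathcal{C}$, $(X,\sigma)\mapsto X$, making $F\dashv U$ a Hopf adjunction.
   Context: Monoidal categories $(\mathcal{C},\otimes,\mathbf 1)$ are assumed strict; object names also denote identity morphisms. Closed means that for every object $A$ the functors $-\otimes A$ and $A\otimes-$ have right adjoints $[A,-]^l$ and $[A,-]^r$. A pivotal pair $(P,Q)$ in $\mathcal{C}$ consists of objects $P,Q$ with morphisms $\mathrm{coev}:\mathbf 1\to P\otimes Q$, $\mathrm{ev}:Q\otimes P\to\mathbf 1$ making $Q$ a left dual of $P$, i.e. $(\mathrm{ev}\otimes Q)(Q\otimes\mathrm{coev})=\mathrm{id}_Q$, $(P\otimes\mathrm{ev})(\mathrm{coev}\otimes P)=\mathrm{id}_P$, and morphisms $\underline{\mathrm{coev}}:\mathbf 1\to Q\otimes P$, $\underline{\mathrm{ev}}:P\otimes Q\to\mathbf 1$ making $Q$ a right dual of $P$, i.e. $(\underline{\mathrm{ev}}\otimes P)(P\otimes\underline{\mathrm{coev}})=\mathrm{id}_P$,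 $(Q\otimes\underline{\mathrm{ev}})(\underline{\mathrm{coev}}\otimes Q)=\mathrm{id}_Q$. The category $\mathcal{C}(P,Q)$: objects are pairs $(X,\sigma)$ with $X$ an object of $\mathcal{C}$ and $\sigma:X\otimes P\to P\otimes X$ an invertible morphism such that the two morphisms $$(\mathrm{ev}\otimes X\otimes Q)(Q\otimes\sigma\otimes Q)(Q\otimes X\otimes\mathrm{coev}):Q\otimes X\to X\otimes Q,$$ $$(Q\otimes X\otimes\underline{\mathrm{ev}})(Q\otimes\sigma^{-1}\otimes Q)(\underline{\mathrm{coev}}\otimes X\otimes Q):X\otimes Q\to Q\otimes X$$ are inverse to each other. Morphisms $(X,\sigma)\to(Y,\tau)$ are morphisms $f:X\to Y$ in $\mathcal{C}$ with $\tau(f\otimes P)=(P\otimes f)\sigma$. It is monoidal via $(X,\sigma)\otimes(Y,\tau)=(X\otimes Y,(\sigma\otimes Y)(X\otimes\tau))$ with unit $(\mathbf 1,\mathrm{id}_P)$, and $U$ is strict monoidal. Construction of $T$: let $F_+(X)=Q\otimes X\otimes P$ and $F_-(X)=P\otimes X\otimes Q$. For a finite (possibly empty) word $w=(i_1,\dots,i_n)$ in $\{+,-\}$ let $F_w=F_{i_1}\cdots F_{i_n}$ ($F_\emptyset=\mathrm{id}_{\mathcal{C}}$), and let $F^{\star}=\coprod_w F_w$ in $\mathrm{End}(\mathcal{C})$ with inclusions $\iota_w:F_w\Rightarrow F^{\star}$. Write $-+w$ and $+-w$ for the words $(-,+,i_1,\dots,i_n)$ and $(+,-,i_1,\dots,i_n)$,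 and $+w$, $-w$ for $(+,i_1,\dots,i_n)$, $(-,i_1,\dots,i_n)$. $T$ is the colimit in $\mathrm{End}(\mathcal{C})$ of the diagram formed by the following four parallel pairs into $F^\star$, for all words $w$: (1) $\iota_{-+w}(P\otimes Q\otimes F_w\otimes\mathrm{coev})$ and $\iota_{w}(\underline{\mathrm{ev}}\otimes F_w)$, from $P\otimes Q\otimes F_w$; (2) $\iota_{+-w}(\underline{\mathrm{coev}}\otimes F_w\otimes Q\otimes P)$ and $\iota_{w}(F_w\otimes\mathrm{ev})$, from $F_w\otimes Q\otimes P$; (3) $\iota_{+-w}(Q\otimes P\otimes F_w\otimes\underline{\mathrm{coev}})$ and $\iota_{w}(\mathrm{ev}\otimes F_w)$, from $Q\otimes P\otimes F_w$; (4) $\iota_{-+w}(\mathrm{coev}\otimes F_w\otimes P\otimes Q)$ and $\iota_{w}(F_w\otimes\underline{\mathrm{ev}})$, from $F_w\otimes P\otimes Q$. Let $\psi:F^{\star}\Rightarrow T$ be the resulting universal natural transformation, and put $\psi_w=\psi\iota_w$, $\psi_0=\psi_\emptyset$. Since $\otimes$ commutes with colimits, the family $\psi_{+w}:Q\otimes F_w\otimes P\Rightarrow T$ induces a unique natural transformation $\alpha:Q\otimes T\otimes P\Rightarrow T$ with $\alpha(Q\otimes\psi_w\otimes P)=\psi_{+w}$ for all $w$, and the family $\psi_{-w}:P\otimes F_w\otimes Q\Rightarrow T$ induces a unique $\beta:P\otimes T\otimes Q\Rightarrow T$ with $\beta(P\otimes\psi_w\otimes Q)=\psi_{-w}$ for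 all $w$. The pair $(T(X),\sigma^T_X)$ is an object of $\mathcal{C}(P,Q)$ for each $X$ in $\mathcal{C}$. Hopf adjunction: an adjunction $F\dashv U$ between closed monoidal categories such that $U$ is strong monoidal, and left closed and right closed, i.e. the canonical morphisms $U([X,Y]^{l})\to[U(X),U(Y)]^{l}$ and $U([X,Y]^{r})\to[U(X),U(Y)]^{r}$ are isomorphisms for all $X,Y$ ($\mathcal{C}(P,Q)$ is closed when $\mathcal{C}$ is).
   Formalization: The four pairs alone need not induce α and β (e.g. P=Q=1 in Set), so natural transformations α, β with their defining equations are assumed, and the diagram may also include F_v applied to the pairs for v in any set of words containing the empty word. *)

(* Defs.v *)
From Stdlib Require Import ssreflect ProofIrrelevance FunctionalExtensionality.
From Stdlib Require Import ClassicalEpsilon List Lia.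
Import ListNotations.

Set Implicit Arguments.
Unset Strict Implicit.
Unset Printing Implicit Defensive.
Set SsrOldRewriteGoalsOrder.

Declare Scope cat_scope.
Delimit Scope cat_scope with cat.
Local Open Scope cat_scope.

Record category : Type := Category {
  ob :> Type;
  hom : ob -> ob -> Type;
  idm : forall A, hom A A;
  comp : forall A B C, hom B C -> hom A B -> hom A C;
  comp_assoc : forall A B C D (h : hom C D) (g : hom B C) (f : hom A B),
    comp h (comp g f) = comp (comp h g) f;
  comp_idl : forall A B (f : hom A B), comp (idm B) f = f;
  comp_idr : forall A B (f : hom A B), comp f (idm A) = f }.

Arguments hom {_} A B.
Arguments idm {_} A.
Arguments comp {_ A B C} g f.
Notation "g ∘ f" := (comp g f) (at level 40, left associativity) : cat_scope.

Definition inverse_pair (C : category) (A B : C) (f : hom A B) (g : hom B A) : Prop :=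
  g ∘ f = idm A /\ f ∘ g = idm B.

Definition is_iso (C : category) (A B : C) (f : hom A B) : Prop :=
  exists g : hom B A, inverse_pair f g.

Record functor (C D : category) : Type := Functor {
  fob :> C -> D;
  fmap : forall A B : C, hom A B -> hom (fob A) (fob B);
  fmap_id : forall A : C, fmap (idm A) = idm (fob A);
  fmap_comp : forall (A B E : C) (g : hom B E) (f : hom A B),
    fmap (g ∘ f) = fmap g ∘ fmap f }.
Arguments fmap {C D} _ {A B} f.

Definition fid (C : category) : functor C C :=
  @Functor C C (fun A => A) (fun A B f => f)
    (fun A => eq_refl) (fun A B E g f => eq_refl).

Program Definition fcomp (C D E : category) (G : functor D E) (F : functor C D) :
    functor C E :=
  @Functor C E (fun A => G (F A)) (fun A B f => fmap G (fmap F f)) _ _.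
Next Obligation. by move=> *; rewrite !fmap_id. Qed.
Next Obligation. by move=> *; rewrite !fmap_comp. Qed.

Record nat_trans (C D : category) (F G : functor C D) : Type := NatTrans {
  ntc :> forall A : C, hom (F A) (G A);
  ntc_nat : forall (A B : C) (f : hom A B), ntc B ∘ fmap F f = fmap G f ∘ ntc A }.
Arguments NatTrans {C D F G} ntc ntc_nat.

Lemma nat_trans_ext (C D : category) (F G : functor C D) (s t : nat_trans F G) :
  (forall A, s A = t A) -> s = t.
Proof.
case: s t => [s hs] [t ht] /= e.
have {}e : s = t by apply: functional_extensionality_dep.
by case: t / e ht => ht; rewrite (proof_irrelevance _ hs ht).
Qed.

Program Definition nat_id (C D : category) (F : functor C D) : nat_trans F F :=
  NatTrans (fun A => idm (F A)) _.
Next Obligation. by move=> *; rewrite comp_idl comp_idr. Qed.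

Program Definition nat_comp (C D : category) (F G H : functor C D)
    (t : nat_trans G H) (s : nat_trans F G) : nat_trans F H :=
  NatTrans (fun A => t A ∘ s A) _.
Next Obligation. by move=> *; rewrite -comp_assoc ntc_nat !comp_assoc ntc_nat. Qed.

Program Definition whisker (C D E : category) (K : functor D E) (F G : functor C D)
    (s : nat_trans F G) : nat_trans (fcomp K F) (fcomp K G) :=
  @NatTrans C E (fcomp K F) (fcomp K G) (fun A => fmap K (s A)) _.
Next Obligation. by move=> * /=; rewrite -!fmap_comp ntc_nat. Qed.

Program Definition functor_cat (C D : category) : category :=
  @Category (functor C D) (@nat_trans C D) (@nat_id C D) (@nat_comp C D) _ _ _.
Next Obligation. by move=> *; apply: nat_trans_ext => X /=; rewrite comp_assoc. Qed.
Next Obligation. by move=> *; apply: nat_trans_ext => X /=; rewrite comp_idl. Qed.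
Next Obligation. by move=> *; apply: nat_trans_ext => X /=; rewrite comp_idr. Qed.

Record adjunction (C D : category) (F : functor C D) (G : functor D C) : Type := Adjunction {
  adj_unit : nat_trans (fid C) (fcomp G F);
  adj_counit : nat_trans (fcomp F G) (fid D);
  adj_triangle_l : forall A : C, adj_counit (F A) ∘ fmap F (adj_unit A) = idm (F A);
  adj_triangle_r : forall B : D, fmap G (adj_counit B) ∘ adj_unit (G B) = idm (G B) }.

Record arrow (C : category) : Type := Arrow { adom : C; acod : C; amap : hom adom acod }.
Arguments Arrow {C adom acod} amap.

(* Identities embed the objects into the morphisms, so that the objects of a
   countable category are countable too. *)
Definition countable_cat (J : category) : Prop :=
  exists code : arrow J -> nat, forall a b, code a = code b -> a = b.

Record cocone (J C : category) (D : functor J C) : Type := Cocone {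
  tip : C;
  leg : forall j : J, hom (D j) tip;
  leg_nat : forall (i j : J) (u : hom i j), leg j ∘ fmap D u = leg i }.
Arguments leg {J C D} _ j.

Definition is_colimit (J C : category) (D : functor J C) (L : cocone D) : Prop :=
  forall K : cocone D,
    exists! h : hom (tip L) (tip K), forall j : J, h ∘ leg L j = leg K j.

Definition has_countable_colimits (C : category) : Prop :=
  forall (J : category) (D : functor J C), countable_cat J ->
    exists L : cocone D, is_colimit L.

Definition is_coproduct (C : category) (I : Type) (X : I -> C) (S : C)
    (i : forall k, hom (X k) S) : Prop :=
  forall (Z : C) (f : forall k, hom (X k) Z),
    exists! h : hom S Z, forall k, h ∘ i k = f k.

(* Colimit of a family of parallel pairs f k, g k : X k -> B with common
   target: a cocone on this diagram is determined by its leg h at B, the leg at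
   X k being the common value of h ∘ f k and h ∘ g k. *)
Definition coequalizes (C : category) (I : Type) (X : I -> C) (B : C)
    (f g : forall k, hom (X k) B) (Z : C) (h : hom B Z) : Prop :=
  forall k, h ∘ f k = h ∘ g k.

Definition is_colimit_of_pairs (C : category) (I : Type) (X : I -> C) (B : C)
    (f g : forall k, hom (X k) B) (L : C) (p : hom B L) : Prop :=
  coequalizes f g p /\
  forall (Z : C) (h : hom B Z), coequalizes f g h -> exists! u : hom L Z, u ∘ p = h.

(* Equality of morphisms whose domains and codomains need not be syntactically
   the same objects. *)
Notation "f ≈ g" := (Arrow f = Arrow g) (at level 70, no associativity) : cat_scope.

Record strict_monoidal : Type := StrictMonoidal {
  mcat :> category;
  tens : mcat -> mcat -> mcat;
  munit : mcat;
  tensm : forall A A' B B' : mcat,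
    hom A A' -> hom B B' -> hom (tens A B) (tens A' B');
  tensm_id : forall A B : mcat, tensm (idm A) (idm B) = idm (tens A B);
  tensm_comp : forall (A A' A'' B B' B'' : mcat) (g : hom A' A'') (f : hom A A')
      (g' : hom B' B'') (f' : hom B B'),
    tensm (g ∘ f) (g' ∘ f') = tensm g g' ∘ tensm f f';
  tens_assoc : forall A B C : mcat, tens A (tens B C) = tens (tens A B) C;
  tens_unitl : forall A : mcat, tens munit A = A;
  tens_unitr : forall A : mcat, tens A munit = A;
  tensm_assoc : forall (A A' B B' C C' : mcat)
      (f : hom A A') (g : hom B B') (h : hom C C'),
    tensm f (tensm g h) ≈ tensm (tensm f g) h;
  tensm_unitl : forall (A A' : mcat) (f : hom A A'), tensm (idm munit) f ≈ f;
  tensm_unitr : forall (A A' : mcat) (f : hom A A'), tensm f (idm munit) ≈ f }.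

Arguments tens {_} A B.
Arguments munit {_}.
Arguments tensm {_ A A' B B'} f g.
Notation "A ⊗ B" := (tens A B) (at level 34, left associativity) : cat_scope.
Notation "f ⊠ g" := (tensm f g) (at level 34, left associativity) : cat_scope.
Notation "A ◁ f" := (tensm (idm A) f) (at level 33, right associativity) : cat_scope.
Notation "f ▷ A" := (tensm f (idm A)) (at level 32, left associativity) : cat_scope.

Definition cast (C : category) (A A' B B' : C) (eA : A = A') (eB : B = B')
    (f : hom A B) : hom A' B' :=
  match eA in _ = A0, eB in _ = B0 return hom A0 B0 with
  | eq_refl, eq_refl => f
  end.

(* Equalities of objects that hold by strictness, found by instance search. *)
Class strict_eq (C : category) (A B : C) : Prop := strict_eq_prf : A = B.
Arguments strict_eq_prf {C A B} _.
#[export] Hint Mode strict_eq - + + : typeclass_instances.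

Ltac strict_ob :=
  repeat (rewrite tens_assoc || rewrite tens_unitl || rewrite tens_unitr);
  reflexivity.
#[export] Hint Extern 0 (strict_eq _ _) => (red; strict_ob) : typeclass_instances.

(* Composition, and change of domain and codomain, along such equalities. *)
Definition ccomp (C : category) (A B B' E : C) (e : strict_eq B B') (g : hom B' E)
    (f : hom A B) : hom A E :=
  g ∘ cast eq_refl (strict_eq_prf e) f.
Arguments ccomp {C A B B' E e} g f.
Notation "g ⊙ f" := (ccomp g f) (at level 40, left associativity) : cat_scope.

Definition ccast (C : category) (A A' B B' : C) (eA : strict_eq A A')
    (eB : strict_eq B B') (f : hom A B) : hom A' B' :=
  cast (strict_eq_prf eA) (strict_eq_prf eB) f.
Arguments ccast {C A A' B B' eA eB} f.
Notation "⌈ f ⌉" := (ccast f) (at level 0, f at level 200) : cat_scope.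

(* Composition is made total on [arrow C], so that equations between composites
   along equalities of objects become rewritable. *)

Lemma arrow_inj (C : category) (A B : C) (f g : hom A B) : f ≈ g -> f = g.
Proof.
move=> e; have /= h : forall (a : arrow C) (e1 : adom a = A) (e2 : acod a = B),
    a = Arrow g -> cast e1 e2 (amap a) = g.
  move=> a e1 e2 ea; subst a; simpl in *.
  by rewrite (proof_irrelevance _ e1 eq_refl) (proof_irrelevance _ e2 eq_refl).
exact: (h _ (eq_refl : adom (Arrow f) = A) (eq_refl : acod (Arrow f) = B) e).
Qed.

Lemma cast_arrow (C : category) (A A' B B' : C) (eA : A = A') (eB : B = B')
  (f : hom A B) : cast eA eB f ≈ f.
Proof. by destruct eA, eB. Qed.

Lemma ccast_arrow (C : category) (A A' B B' : C) (eA : strict_eq A A')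
  (eB : strict_eq B B') (f : hom A B) : Arrow (ccast (eA := eA) (eB := eB) f) = Arrow f.
Proof. exact: cast_arrow. Qed.

Definition acomp (C : category) (b a : arrow C) : arrow C :=
  match excluded_middle_informative (acod a = adom b) with
  | left e => Arrow (ccomp (e := e) (amap b) (amap a))
  | right _ => a
  end.
Definition aid (C : category) (A : C) : arrow C := Arrow (idm A).
Lemma aidE (C : category) (A : C) : Arrow (idm A) = aid A.
Proof. by []. Qed.

Definition atens (M : strict_monoidal) (a b : arrow M) : arrow M :=
  Arrow (amap a ⊠ amap b).

Lemma ccomp_arrow (C : category) (A B B' E : C) (e : strict_eq B B') (g : hom B' E)
  (f : hom A B) : Arrow (ccomp (e := e) g f) = acomp (Arrow g) (Arrow f).
Proof.
rewrite /acomp /=; case: excluded_middle_informative => [e'|//] /=.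
by rewrite (proof_irrelevance _ e e').
Qed.

Lemma comp_arrow (C : category) (A B E : C) (g : hom B E) (f : hom A B) :
  Arrow (g ∘ f) = acomp (Arrow g) (Arrow f).
Proof. exact: (@ccomp_arrow C _ _ _ _ eq_refl g f). Qed.

Lemma tensm_arrow (M : strict_monoidal) (A A' B B' : M) (f : hom A A') (g : hom B B') :
  Arrow (f ⊠ g) = atens (Arrow f) (Arrow g).
Proof. by []. Qed.

Lemma adom_acomp (C : category) (b a : arrow C) :
  acod a = adom b -> adom (acomp b a) = adom a.
Proof. by rewrite /acomp; case: excluded_middle_informative. Qed.

Lemma acod_acomp (C : category) (b a : arrow C) :
  acod a = adom b -> acod (acomp b a) = acod b.
Proof. by rewrite /acomp; case: excluded_middle_informative. Qed.

Lemma acompA (C : category) (c b a : arrow C) :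
  acod a = adom b -> acod b = adom c -> acomp c (acomp b a) = acomp (acomp c b) a.
Proof.
case: a b c => [A1 A2 a] [B1 B2 b] [C1 C2 c] /= e1 e2; subst B1 C1.
by rewrite -!comp_arrow comp_assoc.
Qed.

Lemma acomp_idl (C : category) (a : arrow C) A : A = acod a -> acomp (aid A) a = a.
Proof. by case: a => [A1 A2 a] /= ->; rewrite -comp_arrow comp_idl. Qed.

Lemma acomp_idr (C : category) (a : arrow C) A : A = adom a -> acomp a (aid A) = a.
Proof. by case: a => [A1 A2 a] /= ->; rewrite -comp_arrow comp_idr. Qed.

Lemma atens_comp (M : strict_monoidal) (b a b' a' : arrow M) :
  acod a = adom b -> acod a' = adom b' ->
  atens (acomp b a) (acomp b' a') = acomp (atens b b') (atens a a').
Proof.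
case: a b a' b' => [A1 A2 a] [B1 B2 b] [A1' A2' a'] [B1' B2' b'] /= e1 e2.
by subst B1 B1'; rewrite -!comp_arrow /atens /= tensm_comp.
Qed.

Lemma atensA (M : strict_monoidal) (a b c : arrow M) :
  atens a (atens b c) = atens (atens a b) c.
Proof. exact: tensm_assoc. Qed.

Lemma atens_unitl (M : strict_monoidal) (a : arrow M) : atens (aid munit) a = a.
Proof. by case: a => *; exact: tensm_unitl. Qed.

Lemma atens_unitr (M : strict_monoidal) (a : arrow M) : atens a (aid munit) = a.
Proof. by case: a => *; exact: tensm_unitr. Qed.

Lemma aid_tens (M : strict_monoidal) (A B : M) : aid (A ⊗ B) = atens (aid A) (aid B).
Proof. by rewrite /aid -tensm_id. Qed.

Lemma aid_acomp (M : strict_monoidal) (A : M) (b a : arrow M) : acod a = adom b ->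
  atens (aid A) (acomp b a) = acomp (atens (aid A) b) (atens (aid A) a).
Proof. by move=> e; rewrite -atens_comp // acomp_idl. Qed.

Lemma acomp_aid (M : strict_monoidal) (A : M) (b a : arrow M) : acod a = adom b ->
  atens (acomp b a) (aid A) = acomp (atens b (aid A)) (atens a (aid A)).
Proof. by move=> e; rewrite -atens_comp // acomp_idl. Qed.

Lemma exchange (M : strict_monoidal) (a b : arrow M) :
  acomp (atens a (aid (acod b))) (atens (aid (adom a)) b) =
  acomp (atens (aid (acod a)) b) (atens a (aid (adom b))).
Proof. by rewrite -!atens_comp // !acomp_idl // !acomp_idr. Qed.

Ltac to_arrow := rewrite ?(ccomp_arrow, comp_arrow, ccast_arrow, tensm_arrow, aidE).
Ltac flat := rewrite ?aid_tens ?atensA ?atens_unitl ?atens_unitr.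
Ltac bdry := by rewrite ?(adom_acomp, acod_acomp) //=; strict_ob.

Program Definition tens_r (M : strict_monoidal) (A : M) : functor M M :=
  @Functor M M (fun X => X ⊗ A) (fun X Y f => f ▷ A) _ _.
Next Obligation. by move=> *; rewrite tensm_id. Qed.
Next Obligation. by move=> *; rewrite -tensm_comp comp_idl. Qed.

Program Definition tens_l (M : strict_monoidal) (A : M) : functor M M :=
  @Functor M M (fun X => A ⊗ X) (fun X Y f => A ◁ f) _ _.
Next Obligation. by move=> *; rewrite tensm_id. Qed.
Next Obligation. by move=> *; rewrite -tensm_comp comp_idl. Qed.

Record closed (M : strict_monoidal) : Type := Closed {
  lhom : M -> functor M M;
  lhom_adj : forall A : M, adjunction (tens_r A) (lhom A);
  rhom : M -> functor M M;
  rhom_adj : forall A : M, adjunction (tens_l A) (rhom A) }.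

Record strong_monoidal (M N : strict_monoidal) (G : functor M N) : Type := StrongMonoidal {
  sm_tens : forall X Y : M, hom (G X ⊗ G Y) (G (X ⊗ Y));
  sm_unit : hom munit (G munit);
  sm_tens_iso : forall X Y : M, is_iso (sm_tens X Y);
  sm_unit_iso : is_iso sm_unit;
  sm_tens_nat : forall (X X' Y Y' : M) (f : hom X X') (g : hom Y Y'),
    sm_tens X' Y' ∘ (fmap G f ⊠ fmap G g) = fmap G (f ⊠ g) ∘ sm_tens X Y;
  sm_assoc : forall X Y Z : M,
    sm_tens X (Y ⊗ Z) ∘ (G X ◁ sm_tens Y Z)
      ≈ sm_tens (X ⊗ Y) Z ⊙ (sm_tens X Y ▷ G Z);
  sm_unitl : forall X : M, sm_tens munit X ∘ (sm_unit ▷ G X) ≈ idm (G X);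
  sm_unitr : forall X : M, sm_tens X munit ∘ (G X ◁ sm_unit) ≈ idm (G X) }.

Definition lhom_comparison (M N : strict_monoidal) (KM : closed M) (KN : closed N)
    (G : functor M N) (mG : strong_monoidal G) (X Y : M) :
    hom (G (lhom KM X Y)) (lhom KN (G X) (G Y)) :=
  fmap (lhom KN (G X))
    (fmap G (adj_counit (lhom_adj KM X) Y) ∘ sm_tens mG (lhom KM X Y) X)
  ∘ adj_unit (lhom_adj KN (G X)) (G (lhom KM X Y)).

Definition rhom_comparison (M N : strict_monoidal) (KM : closed M) (KN : closed N)
    (G : functor M N) (mG : strong_monoidal G) (X Y : M) :
    hom (G (rhom KM X Y)) (rhom KN (G X) (G Y)) :=
  fmap (rhom KN (G X))
    (fmap G (adj_counit (rhom_adj KM X) Y) ∘ sm_tens mG X (rhom KM X Y))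
  ∘ adj_unit (rhom_adj KN (G X)) (G (rhom KM X Y)).

(* Internal homs are unique up to unique isomorphism compatible with the
   comparison morphisms, so the choice of KM and KN is immaterial. *)
Record hopf_adjunction (N M : strict_monoidal) (F : functor N M) (G : functor M N)
    (mG : strong_monoidal G) : Prop := HopfAdjunction {
  hopf_adj : inhabited (adjunction F G);
  hopf_closed_dom : inhabited (closed N);
  hopf_closed_cod : inhabited (closed M);
  hopf_left_closed : forall (KM : closed M) (KN : closed N) (X Y : M),
    is_iso (lhom_comparison KM KN mG X Y);
  hopf_right_closed : forall (KM : closed M) (KN : closed N) (X Y : M),
    is_iso (rhom_comparison KM KN mG X Y) }.

Record pivotal_pair (M : strict_monoidal) (P Q : M) : Type := PivotalPair {
  coev : hom munit (P ⊗ Q);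
  ev : hom (Q ⊗ P) munit;
  ucoev : hom munit (Q ⊗ P);
  uev : hom (P ⊗ Q) munit;
  ev_coev_Q : (ev ▷ Q) ⊙ (Q ◁ coev) ≈ idm Q;
  ev_coev_P : (P ◁ ev) ⊙ (coev ▷ P) ≈ idm P;
  uev_ucoev_P : (uev ▷ P) ⊙ (P ◁ ucoev) ≈ idm P;
  uev_ucoev_Q : (Q ◁ uev) ⊙ (ucoev ▷ Q) ≈ idm Q }.

Definition mate (M : strict_monoidal) (P Q : M) (pp : pivotal_pair P Q) (X : M)
    (s : hom (X ⊗ P) (P ⊗ X)) : hom (Q ⊗ X) (X ⊗ Q) :=
  ⌈ (ev pp ▷ X ▷ Q) ⊙ ((Q ◁ s) ▷ Q) ⊙ ((Q ⊗ X) ◁ coev pp) ⌉.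

Definition comate (M : strict_monoidal) (P Q : M) (pp : pivotal_pair P Q) (X : M)
    (t : hom (P ⊗ X) (X ⊗ P)) : hom (X ⊗ Q) (Q ⊗ X) :=
  ⌈ ((Q ⊗ X) ◁ uev pp) ⊙ ((Q ◁ t) ▷ Q) ⊙ (ucoev pp ▷ X ▷ Q) ⌉.

Definition pq_cond (M : strict_monoidal) (P Q : M) (pp : pivotal_pair P Q) (X : M)
    (s : hom (X ⊗ P) (P ⊗ X)) : Prop :=
  exists t : hom (P ⊗ X) (X ⊗ P),
    inverse_pair s t /\ inverse_pair (mate pp s) (comate pp t).

Record pq_ob (M : strict_monoidal) (P Q : M) (pp : pivotal_pair P Q) : Type := PQOb {
  pq_carrier : M;
  pq_sig : hom (pq_carrier ⊗ P) (P ⊗ pq_carrier);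
  pq_ok : pq_cond pp pq_sig }.

Record pq_hom (M : strict_monoidal) (P Q : M) (pp : pivotal_pair P Q)
    (X Y : pq_ob pp) : Type := PQHom {
  pq_map : hom (pq_carrier X) (pq_carrier Y);
  pq_comm : pq_sig Y ∘ (pq_map ▷ P) = (P ◁ pq_map) ∘ pq_sig X }.

Lemma pq_hom_ext (M : strict_monoidal) (P Q : M) (pp : pivotal_pair P Q)
  (X Y : pq_ob pp) (f g : pq_hom X Y) : pq_map f = pq_map g -> f = g.
Proof.
case: f g => [f hf] [g hg] /= e; case: g / e hg => hg.
by rewrite (proof_irrelevance _ hf hg).
Qed.

Program Definition pq_id (M : strict_monoidal) (P Q : M) (pp : pivotal_pair P Q)
    (X : pq_ob pp) : pq_hom X X :=
  @PQHom _ _ _ _ X X (idm (pq_carrier X)) _.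
Next Obligation. by move=> *; rewrite !tensm_id comp_idl comp_idr. Qed.

Lemma pq_comp_comm (M : strict_monoidal) (P Q : M) (pp : pivotal_pair P Q)
  (X Y Z : pq_ob pp) (g : pq_hom Y Z) (f : pq_hom X Y) :
  pq_sig Z ∘ ((pq_map g ∘ pq_map f) ▷ P) = (P ◁ (pq_map g ∘ pq_map f)) ∘ pq_sig X.
Proof.
rewrite -(comp_idl (idm P)) !tensm_comp.
by rewrite comp_assoc pq_comm -!comp_assoc pq_comm.
Qed.

Definition pq_comp (M : strict_monoidal) (P Q : M) (pp : pivotal_pair P Q)
    (X Y Z : pq_ob pp) (g : pq_hom Y Z) (f : pq_hom X Y) : pq_hom X Z :=
  PQHom (pq_comp_comm g f).

Program Definition pq_category (M : strict_monoidal) (P Q : M) (pp : pivotal_pair P Q) :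
    category :=
  @Category (pq_ob pp) (@pq_hom M P Q pp) (@pq_id M P Q pp) (@pq_comp M P Q pp) _ _ _.
Next Obligation. by move=> *; apply: pq_hom_ext; rewrite /= comp_assoc. Qed.
Next Obligation. by move=> *; apply: pq_hom_ext; rewrite /= comp_idl. Qed.
Next Obligation. by move=> *; apply: pq_hom_ext; rewrite /= comp_idr. Qed.

Definition pq_tens_sig (M : strict_monoidal) (P X Y : M)
    (s : hom (X ⊗ P) (P ⊗ X)) (t : hom (Y ⊗ P) (P ⊗ Y)) :
    hom (X ⊗ Y ⊗ P) (P ⊗ (X ⊗ Y)) :=
  ⌈ (s ▷ Y) ⊙ (X ◁ t) ⌉.

Definition pq_unit_sig (M : strict_monoidal) (P : M) : hom (munit ⊗ P) (P ⊗ munit) :=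
  ⌈ idm P ⌉.

Lemma mate_arrow (M : strict_monoidal) (P Q : M) (pp : pivotal_pair P Q) (X : M)
  (s : hom (X ⊗ P) (P ⊗ X)) :
  Arrow (mate pp s) =
  acomp (atens (atens (Arrow (ev pp)) (aid X)) (aid Q))
    (acomp (atens (atens (aid Q) (Arrow s)) (aid Q))
      (atens (atens (aid Q) (aid X)) (Arrow (coev pp)))).
Proof. by rewrite /mate; to_arrow; rewrite aid_tens acompA //; bdry. Qed.

Lemma comate_arrow (M : strict_monoidal) (P Q : M) (pp : pivotal_pair P Q) (X : M)
  (t : hom (P ⊗ X) (X ⊗ P)) :
  Arrow (comate pp t) =
  acomp (atens (atens (aid Q) (aid X)) (Arrow (uev pp)))
    (acomp (atens (atens (aid Q) (Arrow t)) (aid Q))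
      (atens (atens (Arrow (ucoev pp)) (aid X)) (aid Q))).
Proof. by rewrite /comate; to_arrow; rewrite aid_tens acompA //; bdry. Qed.

Lemma mate_slide (M : strict_monoidal) (P Q : M) (pp : pivotal_pair P Q) (X : M)
  (s : hom (X ⊗ P) (P ⊗ X)) :
  acomp (atens (aid X) (Arrow (ev pp))) (atens (Arrow (mate pp s)) (aid P)) =
  acomp (atens (Arrow (ev pp)) (aid X)) (atens (aid Q) (Arrow s)).
Proof.
have snake : acomp (atens (aid P) (Arrow (ev pp))) (atens (Arrow (coev pp)) (aid P)) = aid P.
  by have := ev_coev_P pp; to_arrow.
rewrite mate_arrow acomp_aid; last by bdry.
rewrite acomp_aid; last by bdry.
rewrite acompA; [|bdry|bdry].
have -> : acomp (atens (aid X) (Arrow (ev pp)))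
    (atens (atens (atens (Arrow (ev pp)) (aid X)) (aid Q)) (aid P)) =
    acomp (atens (Arrow (ev pp)) (aid X))
      (atens (aid (Q ⊗ P)) (atens (aid X) (Arrow (ev pp)))).
  have := exchange (Arrow (ev pp)) (atens (aid X) (Arrow (ev pp))).
  by rewrite /=; flat=> ->.
rewrite -acompA; [|bdry|bdry]; congr acomp.
rewrite acompA; [|bdry|bdry].
have -> : acomp (atens (aid (Q ⊗ P)) (atens (aid X) (Arrow (ev pp))))
    (atens (atens (atens (aid Q) (Arrow s)) (aid Q)) (aid P)) =
    acomp (atens (aid Q) (Arrow s)) (atens (aid (Q ⊗ X ⊗ P)) (Arrow (ev pp))).
  have := exchange (atens (aid Q) (Arrow s)) (Arrow (ev pp)).
  by rewrite /=; flat=> <-.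
rewrite -acompA; [|bdry|bdry].
rewrite -[RHS](@acomp_idr _ _ (Q ⊗ (X ⊗ P))) //; congr acomp.
have := f_equal (atens (aid (Q ⊗ X))) snake.
by rewrite aid_acomp; [flat|bdry].
Qed.

Lemma comate_slide (M : strict_monoidal) (P Q : M) (pp : pivotal_pair P Q) (X : M)
  (t : hom (P ⊗ X) (X ⊗ P)) :
  acomp (atens (Arrow (comate pp t)) (aid P)) (atens (aid X) (Arrow (ucoev pp))) =
  acomp (atens (aid Q) (Arrow t)) (atens (Arrow (ucoev pp)) (aid X)).
Proof.
have snake : acomp (atens (Arrow (uev pp)) (aid P)) (atens (aid P) (Arrow (ucoev pp))) = aid P.
  by have := uev_ucoev_P pp; to_arrow.
rewrite comate_arrow acomp_aid; last by bdry.
rewrite acomp_aid; last by bdry.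
rewrite -acompA; [|bdry|bdry].
rewrite -acompA; [|bdry|bdry].
have -> : acomp (atens (atens (atens (Arrow (ucoev pp)) (aid X)) (aid Q)) (aid P))
    (atens (aid X) (Arrow (ucoev pp))) =
    acomp (atens (aid (Q ⊗ P)) (atens (aid X) (Arrow (ucoev pp))))
      (atens (Arrow (ucoev pp)) (aid X)).
  have := exchange (Arrow (ucoev pp)) (atens (aid X) (Arrow (ucoev pp))).
  by rewrite /=; flat=> ->.
have slide a : acod a = Q ⊗ (P ⊗ X) ->
    acomp (atens (atens (atens (aid Q) (Arrow t)) (aid Q)) (aid P))
    (acomp (atens (aid (Q ⊗ P)) (atens (aid X) (Arrow (ucoev pp)))) a) =
    acomp (atens (aid (Q ⊗ X ⊗ P)) (Arrow (ucoev pp)))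
      (acomp (atens (aid Q) (Arrow t)) a).
  move=> ea; have e1 := exchange (atens (aid Q) (Arrow t)) (Arrow (ucoev pp)).
  rewrite [LHS]acompA ?[RHS]acompA; try by rewrite /= ?ea; bdry.
  by congr acomp; move: e1; rewrite /=; flat.
rewrite slide; last by bdry.
rewrite acompA; [|bdry|bdry].
rewrite -[RHS](@acomp_idl _ _ (Q ⊗ (X ⊗ P))); last by bdry.
congr acomp.
have := f_equal (atens (aid (Q ⊗ X))) snake.
by rewrite aid_acomp; [flat|bdry].
Qed.

Lemma pq_tens_sig_arrow (M : strict_monoidal) (P X Y : M)
  (s : hom (X ⊗ P) (P ⊗ X)) (t : hom (Y ⊗ P) (P ⊗ Y)) :
  Arrow (pq_tens_sig s t) =
  acomp (atens (Arrow s) (aid Y)) (atens (aid X) (Arrow t)).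
Proof. by rewrite /pq_tens_sig; to_arrow. Qed.

Definition pq_tens_inv (M : strict_monoidal) (P X Y : M)
    (s : hom (P ⊗ X) (X ⊗ P)) (t : hom (P ⊗ Y) (Y ⊗ P)) :
    hom (P ⊗ (X ⊗ Y)) (X ⊗ Y ⊗ P) :=
  ⌈ (X ◁ t) ⊙ (s ▷ Y) ⌉.

Lemma pq_tens_inv_arrow (M : strict_monoidal) (P X Y : M)
  (s : hom (P ⊗ X) (X ⊗ P)) (t : hom (P ⊗ Y) (Y ⊗ P)) :
  Arrow (pq_tens_inv s t) =
  acomp (atens (aid X) (Arrow t)) (atens (Arrow s) (aid Y)).
Proof. by rewrite /pq_tens_inv; to_arrow. Qed.

Lemma mate_tens (M : strict_monoidal) (P Q : M) (pp : pivotal_pair P Q) (X Y : M)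
  (s : hom (X ⊗ P) (P ⊗ X)) (t : hom (Y ⊗ P) (P ⊗ Y)) :
  Arrow (mate pp (pq_tens_sig s t)) =
  acomp (atens (aid X) (Arrow (mate pp t))) (atens (Arrow (mate pp s)) (aid Y)).
Proof.
have slide : acomp (atens (atens (Arrow (ev pp)) (aid X)) (aid (Y ⊗ Q)))
    (atens (atens (aid Q) (Arrow s)) (aid (Y ⊗ Q))) =
    acomp (atens (atens (aid X) (Arrow (ev pp))) (aid (Y ⊗ Q)))
      (atens (atens (Arrow (mate pp s)) (aid P)) (aid (Y ⊗ Q))).
  by rewrite -acomp_aid -?mate_slide ?acomp_aid //; bdry.
have ex1 := exchange (Arrow (mate pp s)) (atens (Arrow t) (aid Q)).
have ex2 := exchange (Arrow (mate pp s)) (atens (aid Y) (Arrow (coev pp))).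
rewrite mate_arrow pq_tens_sig_arrow.
rewrite (@aid_acomp _ Q); last by bdry.
rewrite acomp_aid; last by bdry.
move: slide ex1 ex2; rewrite /=; flat => slide ex1 ex2.
rewrite -[X in acomp _ X]acompA; try by bdry.
rewrite acompA; try by bdry.
rewrite slide -acompA; try by bdry.
rewrite [X in acomp _ X = _]acompA; try by bdry.
rewrite ex1 -acompA; try by bdry.
rewrite ex2 (mate_arrow pp t) aid_acomp; last by bdry.
rewrite aid_acomp; last by bdry.
by flat; rewrite -!acompA //; bdry.
Qed.

Lemma comate_tens (M : strict_monoidal) (P Q : M) (pp : pivotal_pair P Q) (X Y : M)
  (s : hom (P ⊗ X) (X ⊗ P)) (t : hom (P ⊗ Y) (Y ⊗ P)) :
  Arrow (comate pp (pq_tens_inv s t)) =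
  acomp (atens (Arrow (comate pp s)) (aid Y)) (atens (aid X) (Arrow (comate pp t))).
Proof.
have slide : acomp (atens (atens (aid Q) (Arrow s)) (aid (Y ⊗ Q)))
      (atens (atens (Arrow (ucoev pp)) (aid X)) (aid (Y ⊗ Q))) =
    acomp (atens (atens (Arrow (comate pp s)) (aid P)) (aid (Y ⊗ Q)))
      (atens (atens (aid X) (Arrow (ucoev pp))) (aid (Y ⊗ Q))).
  by rewrite -acomp_aid -?comate_slide ?acomp_aid //; bdry.
have ex1 := exchange (Arrow (comate pp s)) (atens (Arrow t) (aid Q)).
have ex2 := exchange (Arrow (comate pp s)) (atens (aid Y) (Arrow (uev pp))).
rewrite comate_arrow pq_tens_inv_arrow.
rewrite (@aid_acomp _ Q); last by bdry.
rewrite acomp_aid; last by bdry.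
move: slide ex1 ex2; rewrite /=; flat => slide ex1 ex2.
rewrite -[X in acomp _ X]acompA; try by bdry.
rewrite slide.
rewrite [X in acomp _ X = _]acompA; try by bdry.
rewrite -ex1 -[X in acomp _ X]acompA; try by bdry.
rewrite acompA; try by bdry.
rewrite -ex2 (comate_arrow pp t) aid_acomp; last by bdry.
rewrite aid_acomp; last by bdry.
by flat; rewrite -!acompA //; bdry.
Qed.

Lemma inverse_pair_arrow (C : category) (A B : C) (f : hom A B) (g : hom B A) :
  inverse_pair f g <->
  acomp (Arrow g) (Arrow f) = aid A /\ acomp (Arrow f) (Arrow g) = aid B.
Proof.
rewrite -!comp_arrow; split=> [[-> ->] //|[e1 e2]].
by split; apply: arrow_inj.
Qed.

Lemma acomp_cancel (M : strict_monoidal) (A B X Y : M) (a a' b b' : arrow M) :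
  adom a = X -> acod a = A -> adom a' = A -> acod a' = X ->
  adom b = Y -> acod b = X -> adom b' = X -> acod b' = Y ->
  acomp a' a = aid X -> acomp b' b = aid Y ->
  acomp (acomp b' a') (acomp a b) = aid Y.
Proof.
move=> e1 e2 e3 e4 e5 e6 e7 e8 ea eb.
rewrite acompA ?acod_acomp ?adom_acomp; try by congruence.
rewrite -(@acompA _ b' a' a); try by congruence.
by rewrite ea acomp_idr ?eb //; congruence.
Qed.

Lemma pq_tens_cond (M : strict_monoidal) (P Q : M) (pp : pivotal_pair P Q) (X Y : M)
  (s : hom (X ⊗ P) (P ⊗ X)) (t : hom (Y ⊗ P) (P ⊗ Y)) :
  pq_cond pp s -> pq_cond pp t -> pq_cond pp (pq_tens_sig s t).
Proof.
case=> [s' [/inverse_pair_arrow [s1 s2] /inverse_pair_arrow [s3 s4]]].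
case=> [t' [/inverse_pair_arrow [t1 t2] /inverse_pair_arrow [t3 t4]]].
have cancel (A B : M) a b Z : acod b = adom a -> acomp a b = aid Z ->
    acomp (atens (atens (aid A) a) (aid B)) (atens (atens (aid A) b) (aid B))
    = aid (A ⊗ Z ⊗ B).
  move=> eab e; rewrite -acomp_aid -?aid_acomp ?e -?aid_tens //=.
  by rewrite eab.
exists (pq_tens_inv s' t'); split; apply/inverse_pair_arrow.
- rewrite pq_tens_sig_arrow pq_tens_inv_arrow; split.
  + apply: (@acomp_cancel _ (P ⊗ X ⊗ Y) (X ⊗ P ⊗ Y)) => //=; try by strict_ob.
    * by have := cancel munit Y _ _ _ _ s1; flat; apply.
    * by have := cancel X munit _ _ _ _ t1; flat; apply.
  + apply: (@acomp_cancel _ (X ⊗ Y ⊗ P) (X ⊗ P ⊗ Y)) => //=; try by strict_ob.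
    * by have := cancel X munit _ _ _ _ t2; flat; apply.
    * by have := cancel munit Y _ _ _ _ s2; flat; apply.
- rewrite mate_tens comate_tens; split.
  + apply: (@acomp_cancel _ (X ⊗ Y ⊗ Q) (X ⊗ Q ⊗ Y)) => //=; try by strict_ob.
    * by have := cancel X munit _ _ _ _ t3; flat; apply.
    * by have := cancel munit Y _ _ _ _ s3; flat; apply.
  + apply: (@acomp_cancel _ (Q ⊗ X ⊗ Y) (X ⊗ Q ⊗ Y)) => //=; try by strict_ob.
    * by have := cancel munit Y _ _ _ _ s4; flat; apply.
    * by have := cancel X munit _ _ _ _ t4; flat; apply.
Qed.

Lemma pq_unit_cond (M : strict_monoidal) (P Q : M) (pp : pivotal_pair P Q) :
  pq_cond pp (pq_unit_sig P).
Proof.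
have es : Arrow (pq_unit_sig P) = aid P by rewrite /pq_unit_sig; to_arrow.
exists (ccast (idm P) : hom (P ⊗ munit) (munit ⊗ P)).
split; apply/inverse_pair_arrow; rewrite ?mate_arrow ?comate_arrow ?es; to_arrow; flat.
  by rewrite !acomp_idl.
have h1 := ev_coev_Q pp; have h2 := uev_ucoev_Q pp; move: h1 h2.
to_arrow => h1 h2.
by rewrite -!aid_tens !acomp_idl //= ?aid_tens ?h1 ?h2 ?acomp_idl //; bdry.
Qed.

Definition pq_tens (M : strict_monoidal) (P Q : M) (pp : pivotal_pair P Q)
    (X Y : pq_ob pp) : pq_ob pp :=
  PQOb (pq_tens_cond (pq_ok X) (pq_ok Y)).

Definition pq_unit (M : strict_monoidal) (P Q : M) (pp : pivotal_pair P Q) : pq_ob pp :=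
  PQOb (pq_unit_cond pp).

Lemma pq_tens_sig_nat (M : strict_monoidal) (P X X' Y Y' : M)
  (s : hom (X ⊗ P) (P ⊗ X)) (s' : hom (X' ⊗ P) (P ⊗ X'))
  (t : hom (Y ⊗ P) (P ⊗ Y)) (t' : hom (Y' ⊗ P) (P ⊗ Y'))
  (f : hom X X') (g : hom Y Y') :
  s' ∘ (f ▷ P) = (P ◁ f) ∘ s -> t' ∘ (g ▷ P) = (P ◁ g) ∘ t ->
  pq_tens_sig s' t' ∘ ((f ⊠ g) ▷ P) = (P ◁ (f ⊠ g)) ∘ pq_tens_sig s t.
Proof.
move=> /(f_equal (@Arrow _ _ _)) hf /(f_equal (@Arrow _ _ _)) hg.
apply: arrow_inj; move: hf hg; to_arrow => hf hg.
rewrite -acompA; [|bdry|bdry].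
have -> : acomp (atens (aid X') (Arrow t')) (atens (atens (Arrow f) (Arrow g)) (aid P))
    = acomp (atens (atens (Arrow f) (aid P)) (Arrow g)) (atens (aid X) (Arrow t)).
  rewrite -!atensA -!atens_comp; try by bdry.
  by rewrite hg acomp_idl ?acomp_idr.
rewrite acompA; [|bdry|bdry].
rewrite -(@atens_comp _ (Arrow s')); [|bdry|bdry].
rewrite hf acomp_idl //; rewrite acompA; [|bdry|bdry]; congr acomp.
rewrite atensA -(@atens_comp _ _ (Arrow s)); [|bdry|bdry].
by rewrite acomp_idr.
Qed.

Lemma pq_tensm_comm (M : strict_monoidal) (P Q : M) (pp : pivotal_pair P Q)
  (X X' Y Y' : pq_ob pp) (f : pq_hom X X') (g : pq_hom Y Y') :
  pq_sig (pq_tens X' Y') ∘ ((pq_map f ⊠ pq_map g) ▷ P) =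
  (P ◁ (pq_map f ⊠ pq_map g)) ∘ pq_sig (pq_tens X Y).
Proof. exact: pq_tens_sig_nat (pq_comm f) (pq_comm g). Qed.

Definition pq_tensm (M : strict_monoidal) (P Q : M) (pp : pivotal_pair P Q)
    (X X' Y Y' : pq_ob pp) (f : pq_hom X X') (g : pq_hom Y Y') :
    pq_hom (pq_tens X Y) (pq_tens X' Y') :=
  @PQHom _ _ _ _ (pq_tens X Y) (pq_tens X' Y') (pq_map f ⊠ pq_map g)
    (pq_tensm_comm f g).

Lemma pq_ob_ext (M : strict_monoidal) (P Q : M) (pp : pivotal_pair P Q) (X Y : pq_ob pp) :
  pq_carrier X = pq_carrier Y -> pq_sig X ≈ pq_sig Y -> X = Y.
Proof.
case: X Y => [X s hs] [Y t ht] /= e; case: Y / e t ht => t ht /arrow_inj e.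
by case: t / e ht => ht; rewrite (proof_irrelevance _ hs ht).
Qed.

Lemma pq_arrow_ext (M : strict_monoidal) (P Q : M) (pp : pivotal_pair P Q)
  (X X' Y Y' : pq_category pp) (f : hom X X') (g : hom Y Y') :
  X = Y -> X' = Y' -> pq_map f ≈ pq_map g -> f ≈ g.
Proof.
by move=> e e'; subst Y Y' => /arrow_inj e; congr Arrow; apply: pq_hom_ext.
Qed.

Lemma pq_tens_assoc (M : strict_monoidal) (P Q : M) (pp : pivotal_pair P Q)
  (X Y Z : pq_ob pp) : pq_tens X (pq_tens Y Z) = pq_tens (pq_tens X Y) Z.
Proof.
apply: pq_ob_ext => /=; first exact: tens_assoc.
rewrite !pq_tens_sig_arrow aid_acomp; last by bdry.
rewrite acomp_aid; last by bdry.
by flat; rewrite -!acompA //; bdry.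
Qed.

Lemma pq_tens_unitl (M : strict_monoidal) (P Q : M) (pp : pivotal_pair P Q)
  (X : pq_ob pp) : pq_tens (pq_unit pp) X = X.
Proof.
apply: pq_ob_ext => /=; first exact: tens_unitl.
rewrite pq_tens_sig_arrow /pq_unit_sig; to_arrow; flat.
by rewrite -aid_tens acomp_idl.
Qed.

Lemma pq_tens_unitr (M : strict_monoidal) (P Q : M) (pp : pivotal_pair P Q)
  (X : pq_ob pp) : pq_tens X (pq_unit pp) = X.
Proof.
apply: pq_ob_ext => /=; first exact: tens_unitr.
rewrite pq_tens_sig_arrow /pq_unit_sig; to_arrow; flat.
by rewrite -aid_tens acomp_idr.
Qed.

Program Definition pq_monoidal (M : strict_monoidal) (P Q : M) (pp : pivotal_pair P Q) :
    strict_monoidal :=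
  @StrictMonoidal (pq_category pp) (@pq_tens M P Q pp) (pq_unit pp)
    (@pq_tensm M P Q pp) _ _ (@pq_tens_assoc M P Q pp) (@pq_tens_unitl M P Q pp)
    (@pq_tens_unitr M P Q pp) _ _ _.
Next Obligation. by move=> *; apply: pq_hom_ext; rewrite /= tensm_id. Qed.
Next Obligation. by move=> *; apply: pq_hom_ext; rewrite /= tensm_comp. Qed.
Next Obligation.
move=> *; apply: pq_arrow_ext; [exact: pq_tens_assoc|exact: pq_tens_assoc|].
exact: tensm_assoc.
Qed.
Next Obligation.
move=> *; apply: pq_arrow_ext; [exact: pq_tens_unitl|exact: pq_tens_unitl|].
exact: tensm_unitl.
Qed.
Next Obligation.
move=> *; apply: pq_arrow_ext; [exact: pq_tens_unitr|exact: pq_tens_unitr|].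
exact: tensm_unitr.
Qed.

Definition pq_forget (M : strict_monoidal) (P Q : M) (pp : pivotal_pair P Q) :
    functor (pq_monoidal pp) M :=
  @Functor (pq_monoidal pp) M (@pq_carrier M P Q pp) (@pq_map M P Q pp)
    (fun A => eq_refl) (fun A B E g f => eq_refl).

Lemma idm_iso (C : category) (A : C) : is_iso (idm A).
Proof. by exists (idm A); split; rewrite comp_idl. Qed.

Program Definition pq_forget_strong (M : strict_monoidal) (P Q : M)
    (pp : pivotal_pair P Q) : strong_monoidal (pq_forget pp) :=
  @StrongMonoidal (pq_monoidal pp) M (pq_forget pp)
    (fun X Y => idm (pq_carrier X ⊗ pq_carrier Y)) (idm munit)
    (fun X Y => idm_iso _) (idm_iso _) _ _ _ _.
Next Obligation. by move=> *; rewrite /= comp_idl comp_idr. Qed.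
Next Obligation.
by move=> *; to_arrow; rewrite -!aid_tens !acomp_idl //= tens_assoc.
Qed.
Next Obligation. by move=> *; to_arrow; rewrite -!aid_tens acomp_idl //= aid_tens atens_unitl. Qed.
Next Obligation. by move=> *; to_arrow; rewrite -!aid_tens acomp_idl //= aid_tens atens_unitr. Qed.

Inductive sign : Type := plus | minus.
Definition word : Type := list sign.

Definition Fsign (M : strict_monoidal) (P Q : M) (i : sign) : functor M M :=
  match i with
  | plus => fcomp (tens_r P) (tens_l Q)
  | minus => fcomp (tens_r Q) (tens_l P)
  end.

Fixpoint Fword (M : strict_monoidal) (P Q : M) (w : word) : functor M M :=
  match w with
  | [] => fid M
  | i :: w' => fcomp (Fsign P Q i) (Fword P Q w')
  end.

(* The four families of parallel pairs. Those of a given kind arise, for all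
   words w, by evaluating at F_w a natural transformation from [rel_src] to
   F_- F_+ or F_+ F_- and one from [rel_src] to the identity. *)
Inductive rel_kind : Type := rel1 | rel2 | rel3 | rel4.

Definition rel_src (M : strict_monoidal) (P Q : M) (k : rel_kind) : functor M M :=
  match k with
  | rel1 => tens_l (P ⊗ Q)
  | rel2 => tens_r (Q ⊗ P)
  | rel3 => tens_l (Q ⊗ P)
  | rel4 => tens_r (P ⊗ Q)
  end.

Definition rel_outer (k : rel_kind) : sign :=
  match k with rel1 | rel4 => minus | rel2 | rel3 => plus end.
Definition rel_inner (k : rel_kind) : sign :=
  match k with rel1 | rel4 => plus | rel2 | rel3 => minus end.

Definition rel_expand_at (M : strict_monoidal) (P Q : M) (pp : pivotal_pair P Q)
    (k : rel_kind) (Z : M) :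
    hom (rel_src P Q k Z) (Fsign P Q (rel_outer k) (Fsign P Q (rel_inner k) Z)) :=
  match k with
  | rel1 => (⌈ (P ⊗ Q ⊗ Z) ◁ coev pp ⌉ : hom (P ⊗ Q ⊗ Z) (P ⊗ (Q ⊗ Z ⊗ P) ⊗ Q))
  | rel2 => (⌈ ucoev pp ▷ (Z ⊗ Q ⊗ P) ⌉ : hom (Z ⊗ (Q ⊗ P)) (Q ⊗ (P ⊗ Z ⊗ Q) ⊗ P))
  | rel3 => (⌈ (Q ⊗ P ⊗ Z) ◁ ucoev pp ⌉ : hom (Q ⊗ P ⊗ Z) (Q ⊗ (P ⊗ Z ⊗ Q) ⊗ P))
  | rel4 => (⌈ coev pp ▷ (Z ⊗ P ⊗ Q) ⌉ : hom (Z ⊗ (P ⊗ Q)) (P ⊗ (Q ⊗ Z ⊗ P) ⊗ Q))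
  end.

Definition rel_contract_at (M : strict_monoidal) (P Q : M) (pp : pivotal_pair P Q)
    (k : rel_kind) (Z : M) : hom (rel_src P Q k Z) Z :=
  match k with
  | rel1 => (⌈ uev pp ▷ Z ⌉ : hom (P ⊗ Q ⊗ Z) Z)
  | rel2 => (⌈ Z ◁ ev pp ⌉ : hom (Z ⊗ (Q ⊗ P)) Z)
  | rel3 => (⌈ ev pp ▷ Z ⌉ : hom (Q ⊗ P ⊗ Z) Z)
  | rel4 => (⌈ Z ◁ uev pp ⌉ : hom (Z ⊗ (P ⊗ Q)) Z)
  end.

Lemma rel_expand_nat (M : strict_monoidal) (P Q : M) (pp : pivotal_pair P Q)
  (k : rel_kind) (Z Z' : M) (f : hom Z Z') :
  rel_expand_at pp k Z' ∘ fmap (rel_src P Q k) f =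
  fmap (Fsign P Q (rel_outer k)) (fmap (Fsign P Q (rel_inner k)) f)
    ∘ rel_expand_at pp k Z.
Proof.
apply: arrow_inj; case: k => /=; to_arrow.
- have := exchange (atens (aid (P ⊗ Q)) (Arrow f)) (Arrow (coev pp)).
  by rewrite /=; flat=> ->.
- have := exchange (Arrow (ucoev pp)) (atens (Arrow f) (aid (Q ⊗ P))).
  by rewrite /=; flat=> ->.
- have := exchange (atens (aid (Q ⊗ P)) (Arrow f)) (Arrow (ucoev pp)).
  by rewrite /=; flat=> ->.
- have := exchange (Arrow (coev pp)) (atens (Arrow f) (aid (P ⊗ Q))).
  by rewrite /=; flat=> ->.
Qed.

Lemma rel_contract_nat (M : strict_monoidal) (P Q : M) (pp : pivotal_pair P Q)
  (k : rel_kind) (Z Z' : M) (f : hom Z Z') :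
  rel_contract_at pp k Z' ∘ fmap (rel_src P Q k) f = f ∘ rel_contract_at pp k Z.
Proof.
apply: arrow_inj; case: k => /=; to_arrow.
- have := exchange (Arrow (uev pp)) (Arrow f).
  by rewrite /=; flat=> ->.
- have := exchange (Arrow f) (Arrow (ev pp)).
  by rewrite /=; flat=> ->.
- have := exchange (Arrow (ev pp)) (Arrow f).
  by rewrite /=; flat=> ->.
- have := exchange (Arrow f) (Arrow (uev pp)).
  by rewrite /=; flat=> ->.
Qed.

Definition rel_source (M : strict_monoidal) (P Q : M) (r : rel_kind * word) :
    functor_cat M M :=
  fcomp (rel_src P Q (fst r)) (Fword P Q (snd r)).

Definition rel_expand (M : strict_monoidal) (P Q : M) (pp : pivotal_pair P Q)
    (r : rel_kind * word) :
    nat_trans (rel_source P Q r)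
      (Fword P Q (rel_outer (fst r) :: rel_inner (fst r) :: snd r)) :=
  @NatTrans _ _ (rel_source P Q r)
    (Fword P Q (rel_outer (fst r) :: rel_inner (fst r) :: snd r))
    (fun X => rel_expand_at pp (fst r) (Fword P Q (snd r) X))
    (fun X Y f => rel_expand_nat pp (fst r) (fmap (Fword P Q (snd r)) f)).

Definition rel_contract (M : strict_monoidal) (P Q : M) (pp : pivotal_pair P Q)
    (r : rel_kind * word) :
    nat_trans (rel_source P Q r) (Fword P Q (snd r)) :=
  @NatTrans _ _ (rel_source P Q r) (Fword P Q (snd r))
    (fun X => rel_contract_at pp (fst r) (Fword P Q (snd r) X))
    (fun X Y f => rel_contract_nat pp (fst r) (fmap (Fword P Q (snd r)) f)).

(* F_v K, and F_v t as a transformation into F_(vu). *)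
Fixpoint Fprefix (M : strict_monoidal) (P Q : M) (v : word) (K : functor M M) :
    functor M M :=
  match v with
  | [] => K
  | i :: v' => fcomp (Fsign P Q i) (Fprefix P Q v' K)
  end.

Fixpoint prefix (M : strict_monoidal) (P Q : M) (v u : word) (K : functor M M)
    (t : nat_trans K (Fword P Q u)) :
    nat_trans (Fprefix P Q v K) (Fword P Q (v ++ u)) :=
  match v with
  | [] => t
  | i :: v' => whisker (Fsign P Q i) (prefix v' t)
  end.

(* With V = {[]}, the diagram below consists of the four families of parallel
   pairs rel1, ..., rel4, evaluated at F_w for all words w. Coequalizing only
   these pairs does not ensure that the families psi_(+w) and psi_(-w) induce
   transformations alpha and beta: for P = Q = 1 in Set, psi_(+-) = psi_[] but
   psi_(++-) and psi_(+) differ. When F_v applied to the pairs is coequalized as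
   well, for every word v, alpha and beta exist ([induced_exists]). The set V
   records which F_v are applied. If V contains [] and alpha and beta exist, then
   T coequalizes F_v applied to the pairs for every v, in V or not. *)
Definition pair_index (V : word -> Prop) : Type :=
  ({ v : word | V v } * (rel_kind * word))%type.

Definition pair_source (M : strict_monoidal) (P Q : M) (V : word -> Prop)
    (r : pair_index V) : functor_cat M M :=
  Fprefix P Q (proj1_sig (fst r)) (rel_source P Q (snd r)).

Record T_construction (M : strict_monoidal) (P Q : M) (pp : pivotal_pair P Q)
    (V : word -> Prop) : Type := TConstruction {
  Fstar : functor M M;
  Finj : forall w : word, nat_trans (Fword P Q w) Fstar;
  Fstar_coproduct : @is_coproduct (functor_cat M M) word (Fword P Q) Fstar Finj;
  Tfun : functor M M;
  psi : nat_trans Fstar Tfun;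
  Tfun_colimit : @is_colimit_of_pairs (functor_cat M M) (pair_index V)
    (@pair_source M P Q V) Fstar
    (fun '(exist _ v _, (k, w)) =>
       nat_comp (Finj (v ++ rel_outer k :: rel_inner k :: w))
         (prefix v (rel_expand pp (k, w))))
    (fun '(exist _ v _, (k, w)) =>
       nat_comp (Finj (v ++ w)) (prefix v (rel_contract pp (k, w))))
    Tfun psi }.

Definition psi_word (M : strict_monoidal) (P Q : M) (pp : pivotal_pair P Q)
    (V : word -> Prop) (T : T_construction pp V) (w : word) : nat_trans (Fword P Q w) (Tfun T) :=
  nat_comp (psi T) (Finj T w).

(* is_induced plus a and is_induced minus b characterize a = α and b = β. *)
Definition is_induced (M : strict_monoidal) (P Q : M) (pp : pivotal_pair P Q)
    (V : word -> Prop) (T : T_construction pp V) (i : sign)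
    (a : nat_trans (fcomp (Fsign P Q i) (Tfun T)) (Tfun T)) : Prop :=
  forall w : word,
    nat_comp a (whisker (Fsign P Q i) (psi_word T w)) = psi_word T (i :: w).

Arguments is_induced {M P Q pp V T} i a.

Definition sigma_T (M : strict_monoidal) (P Q : M) (pp : pivotal_pair P Q)
    (V : word -> Prop) (T : T_construction pp V)
    (alpha : nat_trans (fcomp (Fsign P Q plus) (Tfun T)) (Tfun T)) (X : M) :
    hom (Tfun T X ⊗ P) (P ⊗ Tfun T X) :=
  ⌈ (P ◁ (alpha X : hom (Q ⊗ Tfun T X ⊗ P) (Tfun T X))) ⊙ (coev pp ▷ Tfun T X ▷ P) ⌉.

Lemma sigma_T_nat (M : strict_monoidal) (P Q : M) (pp : pivotal_pair P Q)
  (V : word -> Prop) (T : T_construction pp V)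
  (alpha : nat_trans (fcomp (Fsign P Q plus) (Tfun T)) (Tfun T))
  (X Y : M) (f : hom X Y) :
  sigma_T alpha Y ∘ (fmap (Tfun T) f ▷ P) = (P ◁ fmap (Tfun T) f) ∘ sigma_T alpha X.
Proof.
have hn := f_equal (@Arrow _ _ _) (ntc_nat alpha f).
apply: arrow_inj; move: hn; rewrite /= /sigma_T; to_arrow => hn.
have ex := exchange (Arrow (coev pp)) (atens (Arrow (fmap (Tfun T) f)) (aid P)).
rewrite -acompA; [|bdry|bdry].
move: ex; rewrite /=; flat => ->.
rewrite [RHS]acompA; [|bdry|bdry].
rewrite -aid_acomp; last by bdry.
rewrite -hn aid_acomp; last by bdry.
by rewrite -acompA; [flat|bdry|bdry].
Qed.

Program Definition free_functor (M : strict_monoidal) (P Q : M) (pp : pivotal_pair P Q)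
    (V : word -> Prop) (T : T_construction pp V)
    (alpha : nat_trans (fcomp (Fsign P Q plus) (Tfun T)) (Tfun T))
    (H : forall X : M, pq_cond pp (sigma_T alpha X)) : functor M (pq_monoidal pp) :=
  @Functor M (pq_monoidal pp) (fun X => PQOb (H X))
    (fun X Y f => @PQHom _ _ _ pp (PQOb (H X)) (PQOb (H Y)) (fmap (Tfun T) f)
       (sigma_T_nat alpha f))
    _ _.
Next Obligation. by move=> *; apply: pq_hom_ext; rewrite /= fmap_id. Qed.
Next Obligation. by move=> *; apply: pq_hom_ext; rewrite /= fmap_comp. Qed.

Lemma colimit_hom_ext (J C : category) (D : functor J C) (L : cocone D) (Z : C)
  (h k : hom (tip L) Z) :
  is_colimit L -> (forall j, h ∘ leg L j = k ∘ leg L j) -> h = k.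
Proof.
move=> hL e; pose K := @Cocone J C D Z (fun j => k ∘ leg L j)
  (fun i j u => eq_trans (eq_sym (comp_assoc _ _ _)) (f_equal (comp k) (leg_nat L u))).
have [m [_ hm]] := hL K.
by rewrite -(hm h e) -(hm k (fun j => eq_refl)).
Qed.

Program Definition eval_diagram (J C D : category) (G : functor J (functor_cat C D))
    (A : C) : functor J D :=
  @Functor J D (fun j => G j A) (fun i j u => (fmap G u : nat_trans _ _) A) _ _.
Next Obligation. by move=> *; rewrite fmap_id. Qed.
Next Obligation. by move=> *; rewrite fmap_comp. Qed.

Lemma functor_cat_colimits (C D : category) :
  has_countable_colimits D -> has_countable_colimits (functor_cat C D).
Proof.
move=> hD J G cJ.
have L A := constructive_indefinite_description _ (hD J (eval_diagram G A) cJ).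
have natG i j (u : hom i j) A B (f : hom A B) :
    (fmap G u : nat_trans _ _) B ∘ fmap (G i) f = fmap (G j) f ∘ (fmap G u : nat_trans _ _) A.
  exact: ntc_nat.
pose l A (j : J) : hom (G j A) (tip (proj1_sig (L A))) := leg (proj1_sig (L A)) j.
have lnat A i j (u : hom i j) : l A j ∘ (fmap G u : nat_trans _ _) A = l A i.
  exact: (leg_nat (proj1_sig (L A)) u).
have kont A Z (f : forall j : J, hom (G j A) Z) :
    (forall i j (u : hom i j), f j ∘ (fmap G u : nat_trans _ _) A = f i) ->
    exists! h : hom (tip (proj1_sig (L A))) Z, forall j, h ∘ l A j = f j.
  by move=> hf; apply: (proj2_sig (L A) (@Cocone J D (eval_diagram G A) Z f hf)).
have ext A Z (h k : hom (tip (proj1_sig (L A))) Z) :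
    (forall j, h ∘ l A j = k ∘ l A j) -> h = k.
  exact: colimit_hom_ext (proj2_sig (L A)).
have mor A B (f : hom A B) : {h : hom (tip (proj1_sig (L A))) (tip (proj1_sig (L B))) |
    forall j, h ∘ l A j = l B j ∘ fmap (G j) f}.
  apply: constructive_indefinite_description.
  have [|h [hh _]] := kont A _ (fun j => l B j ∘ fmap (G j) f); last by exists h.
  by move=> i j u; rewrite -comp_assoc -natG comp_assoc lnat.
have tid A : proj1_sig (mor _ _ (idm A)) = idm (tip (proj1_sig (L A))).
  by apply: ext => j; rewrite (proj2_sig (mor _ _ _)) fmap_id comp_idl comp_idr.
have tcomp A B E (g : hom B E) (f : hom A B) :
    proj1_sig (mor _ _ (g ∘ f)) = proj1_sig (mor _ _ g) ∘ proj1_sig (mor _ _ f).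
  apply: ext => j; rewrite (proj2_sig (mor _ _ _)) -comp_assoc (proj2_sig (mor _ _ _)).
  by rewrite comp_assoc (proj2_sig (mor _ _ _)) fmap_comp comp_assoc.
pose T : functor C D := Functor tid tcomp.
pose legT j : nat_trans (G j) T :=
  @NatTrans C D (G j) T (fun A => l A j)
    (fun A B f => eq_sym (proj2_sig (mor A B f) j)).
have legT_nat i j (u : hom i j) : nat_comp (legT j) (fmap G u) = legT i.
  by apply: nat_trans_ext => A; apply: lnat.
exists (@Cocone J (functor_cat C D) G T legT legT_nat) => K.
have hK i j (u : hom i j) A :
    (leg K j : nat_trans _ _) A ∘ (fmap G u : nat_trans _ _) A = (leg K i : nat_trans _ _) A.
  by rewrite -(leg_nat K u).
have cmp A : {h : hom (T A) ((tip K : functor C D) A) |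
    forall j, h ∘ l A j = (leg K j : nat_trans _ _) A}.
  apply: constructive_indefinite_description.
  have [|h [hh _]] := kont A _ (fun j => (leg K j : nat_trans _ _) A); last by exists h.
  by move=> i j u; apply: hK.
have cnat A B (f : hom A B) :
    proj1_sig (cmp B) ∘ fmap T f = fmap (tip K : functor C D) f ∘ proj1_sig (cmp A).
  apply: ext => j; rewrite -!comp_assoc (proj2_sig (cmp A)) [fmap T f]/=.
  rewrite (proj2_sig (mor _ _ _)) comp_assoc (proj2_sig (cmp B)).
  exact: ntc_nat.
exists (@NatTrans C D T (tip K) (fun A => proj1_sig (cmp A)) cnat); split.
  by move=> j; apply: nat_trans_ext => A; apply: (proj2_sig (cmp A)).
move=> t ht; apply: nat_trans_ext => A; apply: ext => j /=.
by rewrite (proj2_sig (cmp A)) -ht.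
Qed.

Program Definition discrete (I : Type) : category :=
  @Category I (fun a b => a = b) (fun a => eq_refl) (fun a b c g f => eq_trans f g) _ _ _.

Program Definition discrete_diagram (C : category) (I : Type) (X : I -> C) :
    functor (discrete I) C :=
  @Functor (discrete I) C X
    (fun a b (e : a = b) => match e in _ = c return hom (X a) (X c) with
       eq_refl => idm (X a) end) _ _.
Next Obligation. by rewrite comp_idl. Qed.

Lemma countable_coproduct (C : category) (I : Type) (code : I -> nat) (X : I -> C) :
  has_countable_colimits C -> (forall a b, code a = code b -> a = b) ->
  exists (S : C) (i : forall k, hom (X k) S), is_coproduct i.
Proof.
move=> hC inj.
pose D := discrete_diagram X.
have [|L hL] := hC _ D.
  exists (fun a : arrow (discrete I) => code (adom a : I)) => [[a a' e] [b b' e']] /= /inj eab.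
  by case: a' / e; case: b' / e'; rewrite eab.
exists (tip L), (leg L) => Z f.
have hf : forall (i j : I) (u : i = j), f j ∘ fmap D u = f i.
  by move=> i j u; case: j / u; apply: comp_idr.
exact: (hL (@Cocone (discrete I) C D Z f hf)).
Qed.

(* The shape of a family of parallel pairs with common target None. *)
Definition pairs_hom (I : Type) (a b : option I) : Type :=
  match a, b with
  | None, None => unit
  | Some _, None => bool
  | Some i, Some j => i = j
  | None, Some _ => Empty_set
  end.

Definition pairs_comp (I : Type) (a b c : option I) :
    pairs_hom b c -> pairs_hom a b -> pairs_hom a c :=
  match a, b, c return pairs_hom b c -> pairs_hom a b -> pairs_hom a c with
  | None, None, None => fun _ _ => tt
  | Some i, None, None => fun _ u => u
  | Some i, Some j, None => fun v _ => v
  | Some i, Some j, Some k => fun v u => eq_trans u v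
  | None, Some _, _ => fun _ u => match u with end
  | _, None, Some _ => fun v _ => match v with end
  end.

Definition pairs_id (I : Type) (a : option I) : pairs_hom a a :=
  match a return pairs_hom a a with Some i => eq_refl | None => tt end.

Lemma pairs_compA (I : Type) (a b c d : option I) (h : pairs_hom c d)
  (g : pairs_hom b c) (f : pairs_hom a b) :
  pairs_comp h (pairs_comp g f) = pairs_comp (pairs_comp h g) f.
Proof.
by case: a b c d h g f => [a|] [b|] [c|] [d|] //= h g f; try contradiction; subst.
Qed.

Lemma pairs_idl (I : Type) (a b : option I) (f : pairs_hom a b) :
  pairs_comp (pairs_id b) f = f.
Proof. by case: a b f => [a|] [b|] //= f; try contradiction; destruct f. Qed.

Lemma pairs_idr (I : Type) (a b : option I) (f : pairs_hom a b) :
  pairs_comp f (pairs_id a) = f.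
Proof. by case: a b f => [a|] [b|] //= f; try contradiction; destruct f. Qed.

Definition pairs (I : Type) : category :=
  Category (@pairs_compA I) (@pairs_idl I) (@pairs_idr I).

Definition pairs_map (C : category) (I : Type) (X : I -> C) (B : C)
    (f g : forall k, hom (X k) B) (a b : option I) : pairs_hom a b ->
    hom (match a with Some k => X k | None => B end)
        (match b with Some k => X k | None => B end) :=
  match a, b return pairs_hom a b ->
    hom (match a with Some k => X k | None => B end)
        (match b with Some k => X k | None => B end) with
  | None, None => fun _ => idm B
  | Some i, None => fun u => if u then f i else g i
  | Some i, Some j => fun u => match u in _ = c return hom (X i) (X c) with
      eq_refl => idm (X i) end
  | None, Some _ => fun u => match u with end
  end.

Lemma pairs_map_comp (C : category) (I : Type) (X : I -> C) (B : C)
  (f g : forall k, hom (X k) B) (a b c : option I) (v : pairs_hom b c) (u : pairs_hom a b) :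
  pairs_map f g (pairs_comp v u) = pairs_map f g v ∘ pairs_map f g u.
Proof.
by case: a b c v u => [a|] [b|] [c|] //= v u; try contradiction; subst;
  rewrite /= ?comp_idl ?comp_idr.
Qed.

Definition pairs_diagram (C : category) (I : Type) (X : I -> C) (B : C)
    (f g : forall k, hom (X k) B) : functor (pairs I) C :=
  @Functor (pairs I) C (fun a => match a with Some k => X k | None => B end)
    (@pairs_map C I X B f g) (fun a => match a with Some _ => eq_refl | None => eq_refl end)
    (@pairs_map_comp C I X B f g).

Lemma countable_colimit_of_pairs (C : category) (I : Type) (code : I -> nat)
  (X : I -> C) (B : C) (f g : forall k, hom (X k) B) :
  has_countable_colimits C -> (forall a b, code a = code b -> a = b) ->
  exists (L : C) (p : hom B L), is_colimit_of_pairs f g p.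
Proof.
move=> hC inj.
have [|L hL] := hC _ (pairs_diagram f g).
  pose code' (a : arrow (pairs I)) : nat :=
    match a with
    | @Arrow _ None None _ => 0
    | @Arrow _ (Some i) None u => 1 + 3 * code i + (if u : bool then 1 else 0)
    | @Arrow _ (Some i) (Some _) _ => 1 + 3 * code i + 2
    | @Arrow _ None (Some _) u => match u : Empty_set with end
    end.
  exists code' => [[x x' u] [y y' v]].
  destruct x as [a|], x' as [a'|], y as [b|], y' as [b'|]; simpl in *;
    try contradiction; try destruct u; try destruct v; rewrite /code' /= => e;
    first [lia | by [] | assert (eab : a = b) by (apply: inj; lia); subst b; reflexivity].
pose p : hom B (tip L) := leg L None.
have pf k : p ∘ f k = leg L (Some k) := leg_nat L (true : @hom (pairs I) (Some k) None).
have pg k : p ∘ g k = leg L (Some k) := leg_nat L (false : @hom (pairs I) (Some k) None).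
exists (tip L), p; split=> [k|Z h hh]; first by rewrite pf pg.
pose hl (a : option I) : hom (pairs_diagram f g a) Z :=
  match a return hom (pairs_diagram f g a) Z with Some k => h ∘ f k | None => h end.
have hln : forall (a b : pairs I) (u : hom a b), hl b ∘ fmap (pairs_diagram f g) u = hl a.
  move=> a b u; destruct a as [a|], b as [b|]; simpl in *; try contradiction;
    destruct u => /=; by rewrite ?comp_idr ?hh.
have [m [hm hu]] := hL (@Cocone (pairs I) C _ Z hl hln).
exists m; split=> [|n hn]; first exact: (hm None).
apply: hu => -[k|]; last exact: hn.
by rewrite /= -pf comp_assoc hn.
Qed.

Lemma word_code : exists code : word -> nat, forall a b, code a = code b -> a = b.
Proof.
exists (fix c w := match w with [] => 0 | plus :: w => 2 * c w + 1 | minus :: w => 2 * c w + 2 end).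
elim=> [|[] a IH] [|[] b] //; try lia; move=> e; congr cons; apply: IH; lia.
Qed.

Lemma T_construction_exists (M : strict_monoidal) (P Q : M) (pp : pivotal_pair P Q)
  (V : word -> Prop) : has_countable_colimits M -> inhabited (T_construction pp V).
Proof.
move=> /(@functor_cat_colimits M) hM.
have [code inj] := word_code.
have [S [i hi]] := countable_coproduct (Fword P Q : word -> functor_cat M M) hM inj.
pose enc (v w : word) : word := concat (map (fun s => [plus; s]) v) ++ minus :: w.
have enc_inj v w v' w' : enc v w = enc v' w' -> v = v' /\ w = w'.
  elim: v v' => [|s v IH] [|s' v'] //=; first by case.
  by case=> -> /IH [-> ->].
pose code' (r : pair_index V) : nat :=
  4 * code (enc (proj1_sig (fst r)) (snd (snd r)))
  + match fst (snd r) with rel1 => 0 | rel2 => 1 | rel3 => 2 | rel4 => 3 end.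
have inj' a b : code' a = code' b -> a = b.
  case: a b => [[v hv] [k w]] [[v' hv'] [k' w']]; rewrite /code' => e.
  simpl fst in e; simpl snd in e; simpl proj1_sig in e.
  have [ev ew] : v = v' /\ w = w'.
    by apply/enc_inj/inj; case: k e; case: k'; lia.
  subst v' w'; rewrite (proof_irrelevance _ hv hv').
  by case: k e; case: k' => //; lia.
have [T [p hp]] := @countable_colimit_of_pairs (functor_cat M M) (pair_index V) code'
  (@pair_source M P Q V) S
  (fun '(exist _ v _, (k, w)) =>
     nat_comp (i (v ++ rel_outer k :: rel_inner k :: w))
       (prefix v (rel_expand pp (k, w))))
  (fun '(exist _ v _, (k, w)) =>
     nat_comp (i (v ++ w)) (prefix v (rel_contract pp (k, w))))
  hM inj'.
by constructor; exact: (TConstruction hi hp).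
Qed.

Program Definition adj_comp (C D E : category) (F : functor C D) (G : functor D C)
    (F' : functor D E) (G' : functor E D) (a : adjunction F G) (a' : adjunction F' G') :
    adjunction (fcomp F' F) (fcomp G G') :=
  @Adjunction C E (fcomp F' F) (fcomp G G')
    (@NatTrans C C (fid C) (fcomp (fcomp G G') (fcomp F' F))
       (fun A => fmap G (adj_unit a' (F A)) ∘ adj_unit a A) _)
    (@NatTrans E E (fcomp (fcomp F' F) (fcomp G G')) (fid E)
       (fun B => adj_counit a' B ∘ fmap F' (adj_counit a (G' B))) _) _ _.
Next Obligation.
have /= h1 := ntc_nat (adj_unit a) f.
have /= h2 := ntc_nat (adj_unit a') (fmap F f).
by rewrite -comp_assoc h1 !comp_assoc -!fmap_comp h2.
Qed.
Next Obligation.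
have /= h1 := ntc_nat (adj_counit a) (fmap G' f).
have /= h2 := ntc_nat (adj_counit a') f.
by rewrite -comp_assoc -fmap_comp h1 fmap_comp !comp_assoc h2.
Qed.
Next Obligation.
have /= h := ntc_nat (adj_counit a) (adj_unit a' (F A)).
rewrite -comp_assoc -fmap_comp (fmap_comp F) (comp_assoc (adj_counit a _)) h.
by rewrite -comp_assoc adj_triangle_l comp_idr adj_triangle_l.
Qed.
Next Obligation.
have /= h := ntc_nat (adj_unit a') (adj_counit a (G' B)).
rewrite comp_assoc -fmap_comp (fmap_comp G') -(comp_assoc (fmap G' (adj_counit a' B))) -h.
by rewrite comp_assoc adj_triangle_r comp_idl adj_triangle_r.
Qed.

Program Definition transpose (C D : category) (F : functor C D) (G : functor D C)
    (ad : adjunction F G) (B : category) (K : functor B C) (Z : functor B D)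
    (t : nat_trans (fcomp F K) Z) : nat_trans K (fcomp G Z) :=
  @NatTrans B C K (fcomp G Z) (fun X => fmap G (t X) ∘ adj_unit ad (K X)) _.
Next Obligation.
have /= h1 := ntc_nat (adj_unit ad) (fmap K f).
by rewrite -comp_assoc h1 !comp_assoc -!fmap_comp (ntc_nat t).
Qed.

Program Definition untranspose (C D : category) (F : functor C D) (G : functor D C)
    (ad : adjunction F G) (B : category) (K : functor B C) (Z : functor B D)
    (s : nat_trans K (fcomp G Z)) : nat_trans (fcomp F K) Z :=
  @NatTrans B D (fcomp F K) Z (fun X => adj_counit ad (Z X) ∘ fmap F (s X)) _.
Next Obligation.
have /= h1 := ntc_nat (adj_counit ad) (fmap Z f).
by rewrite -comp_assoc -fmap_comp (ntc_nat s) (fmap_comp F) !comp_assoc h1.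
Qed.

Lemma transposeK (C D : category) (F : functor C D) (G : functor D C)
  (ad : adjunction F G) (B : category) (K : functor B C) (Z : functor B D)
  (t : nat_trans (fcomp F K) Z) : untranspose ad (transpose ad t) = t.
Proof.
apply: nat_trans_ext => X /=; have /= h := ntc_nat (adj_counit ad) (t X).
by rewrite fmap_comp comp_assoc h -comp_assoc adj_triangle_l comp_idr.
Qed.

Lemma untransposeK (C D : category) (F : functor C D) (G : functor D C)
  (ad : adjunction F G) (B : category) (K : functor B C) (Z : functor B D)
  (s : nat_trans K (fcomp G Z)) : transpose ad (untranspose ad s) = s.
Proof.
apply: nat_trans_ext => X /=; have /= h := ntc_nat (adj_unit ad) (s X).
by rewrite fmap_comp -comp_assoc -h comp_assoc adj_triangle_r comp_idl.
Qed.

Lemma transpose_whisker (C D : category) (F : functor C D) (G : functor D C)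
  (ad : adjunction F G) (B : category) (K K' : functor B C) (Z : functor B D)
  (t : nat_trans (fcomp F K) Z) (m : nat_trans K' K) :
  transpose ad (nat_comp t (whisker F m)) = nat_comp (transpose ad t) m.
Proof.
apply: nat_trans_ext => X /=; have /= h := ntc_nat (adj_unit ad) (m X).
by rewrite fmap_comp -!comp_assoc h.
Qed.

Lemma nat_comp_assoc (C D : category) (F G H K : functor C D) (t : nat_trans H K)
  (s : nat_trans G H) (r : nat_trans F G) :
  nat_comp t (nat_comp s r) = nat_comp (nat_comp t s) r.
Proof. exact: (@comp_assoc (functor_cat C D)). Qed.

Lemma induced_exists (M : strict_monoidal) (P Q : M) (pp : pivotal_pair P Q)
  (V : word -> Prop) (T : T_construction pp V) (i : sign) :
  closed M -> (forall v, V v) ->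
  exists! a : nat_trans (fcomp (Fsign P Q i) (Tfun T)) (Tfun T), is_induced i a.
Proof.
move=> KM fullV.
have [G ad] : {G : functor M M & adjunction (Fsign P Q i) G}.
  case: i; eexists.
    exact: (adj_comp (rhom_adj KM Q) (lhom_adj KM P)).
  exact: (adj_comp (rhom_adj KM P) (lhom_adj KM Q)).
pose hw w : nat_trans (Fword P Q w) (fcomp G (Tfun T)) :=
  transpose ad (psi_word T (i :: w)).
have [h [hh hu]] := Fstar_coproduct T (Z := fcomp G (Tfun T) : functor_cat M M) hw.
have [eqT univT] := Tfun_colimit T.
have coeq v k w (hv : V v) :
    nat_comp h (nat_comp (Finj T (v ++ rel_outer k :: rel_inner k :: w))
      (prefix v (rel_expand pp (k, w)))) =
    nat_comp h (nat_comp (Finj T (v ++ w)) (prefix v (rel_contract pp (k, w)))).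
  rewrite !nat_comp_assoc (hh (v ++ _) : nat_comp h (Finj T _) = _).
  rewrite (hh (v ++ w) : nat_comp h (Finj T _) = _) /hw -!transpose_whisker.
  congr transpose; rewrite /psi_word -!nat_comp_assoc.
  exact: (eqT (exist V (i :: v) (fullV _), (k, w))).
have [|u [hu1 hu2]] := univT (fcomp G (Tfun T)) h.
  by case=> [[v hv] [k w]]; apply: coeq.
exists (untranspose ad u); split=> [w|a ha].
  rewrite -[LHS](transposeK ad) transpose_whisker untransposeK.
  rewrite -[RHS](transposeK ad); congr untranspose.
  rewrite /psi_word nat_comp_assoc (hu1 : nat_comp u (psi T) = h).
  exact: hh.
rewrite -[RHS](transposeK ad); congr untranspose.
apply: hu2; symmetry; apply: hu => w.
rewrite -[LHS]/(nat_comp (nat_comp (transpose ad a) (psi T)) (Finj T w)).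
by rewrite -nat_comp_assoc -transpose_whisker [nat_comp a _]ha.
Qed.

(* Main.v *)
From Stdlib Require Import ssreflect ProofIrrelevance ClassicalEpsilon List Cantor.
Require Import Defs.
Import ListNotations.

Set Implicit Arguments.
Unset Strict Implicit.
Unset Printing Implicit Defensive.
Set SsrOldRewriteGoalsOrder.
Local Open Scope cat_scope.

(** The condition defining C(P,Q) is an algebraic structure in disguise. By the
    snake identities a morphism s : X ⊗ P → P ⊗ X is the same as a morphism
    a : Q ⊗ X ⊗ P → X, and t : P ⊗ X → X ⊗ P is the same as b : P ⊗ X ⊗ Q → X.
    The mate of s and the comate of t are transposes of a and b as well, with the
    wire on the other side bent. Along these four bijections the equations
    s t = 1, t s = 1, mate ∘ comate = 1 and comate ∘ mate = 1 turn, one by one,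
    into the four equations between a F_+(b) or b F_-(a) and a contraction that the
    four families of parallel pairs express ([is_actionP]). So an object of C(P,Q)
    is an object X with an action of F_+ and F_- obeying these equations, and a
    morphism is a map commuting with a, hence also with b ([action_hom]).

    Seen this way, T(X) is the free action on X: the coproduct of the F_w(X) is free
    on the two operations, and the colimit imposes the four equations. Two points
    need an argument. The colimit is taken in End(C), whereas freeness concerns one
    object at a time; as C has countable colimits, the colimit is computed pointwise
    ([quotient_pointwise], [T_quotient]). And alpha, beta make T(X) an action because
    F_+, F_- and the sources of the pairs preserve jointly epic families, being left
    adjoints ([T_action]). The universal property is [T_extend].

    For the Hopf part, an object X of C(P,Q) gives isomorphisms
    F_i(H) ⊗ X ≅ F_i(H ⊗ X) and X ⊗ F_i(H) ≅ F_i(X ⊗ H) which pass through the four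
    equations ([tens_r_law], [tens_l_law]). For any functor with such isomorphisms the
    right adjoint carries actions to actions, and transposition along the adjunction
    respects morphisms of actions in both directions ([hom_act_action],
    [hom_lift]). So the internal homs of C underlie internal homs of C(P,Q) with
    the same evaluation, and the comparison morphisms are isomorphisms by uniqueness
    of couniversal arrows. *)

(** * Bending wires along a duality *)

(** Composites of arrows are written in the total composition of [arrow], where
    strict associativity and unitality of ⊗ are equations between arrows. *)
Definition snake (M : strict_monoidal) (A B : M) (h : hom munit (A ⊗ B))
    (e : hom (B ⊗ A) munit) : Prop :=
  acomp (atens (aid A) (Arrow e)) (atens (Arrow h) (aid A)) = aid A /\
  acomp (atens (Arrow e) (aid B)) (atens (aid B) (Arrow h)) = aid B.

Definition lcurry (M : strict_monoidal) (A B : M) (h : hom munit (A ⊗ B)) (X : M)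
    (f : arrow M) : arrow M :=
  acomp (atens (aid A) f) (atens (Arrow h) (aid X)).
Definition luncurry (M : strict_monoidal) (A B : M) (e : hom (B ⊗ A) munit) (Y : M)
    (g : arrow M) : arrow M :=
  acomp (atens (Arrow e) (aid Y)) (atens (aid B) g).
Definition rcurry (M : strict_monoidal) (A B : M) (h : hom munit (A ⊗ B)) (X : M)
    (f : arrow M) : arrow M :=
  acomp (atens f (aid B)) (atens (aid X) (Arrow h)).
Definition runcurry (M : strict_monoidal) (A B : M) (e : hom (B ⊗ A) munit) (Y : M)
    (g : arrow M) : arrow M :=
  acomp (atens (aid Y) (Arrow e)) (atens g (aid A)).

(** Like [bdry], but recursive: for nested composites, [adom_acomp] and [acod_acomp]
    produce composability conditions of the same kind. *)
Ltac bd :=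
  repeat (simpl; first
    [ progress rewrite /lcurry /rcurry /luncurry /runcurry
    | rewrite adom_acomp; [|solve [bd]] | rewrite acod_acomp; [|solve [bd]] ]);
  simpl; strict_ob.

Lemma lcurryK (M : strict_monoidal) (A B X Y : M) (h : hom munit (A ⊗ B))
  (e : hom (B ⊗ A) munit) (f : arrow M) : snake h e ->
  adom f = B ⊗ X -> acod f = Y -> luncurry e Y (lcurry h X f) = f.
Proof.
case=> _ sB; case: f => [Z Y' f] /= eZ eY; subst Z Y'.
rewrite /luncurry /lcurry aid_acomp; last by bd.
rewrite acompA; [|bd|bd].
have := exchange (Arrow e) (Arrow f); rewrite /=; flat=> ->.
rewrite -acompA; [|bd|bd].
rewrite -acomp_aid; last by bd.
by rewrite sB -aid_tens acomp_idr.
Qed.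

Lemma luncurryK (M : strict_monoidal) (A B X Y : M) (h : hom munit (A ⊗ B))
  (e : hom (B ⊗ A) munit) (g : arrow M) : snake h e ->
  adom g = X -> acod g = A ⊗ Y -> lcurry h X (luncurry e Y g) = g.
Proof.
case=> sA _; case: g => [X' Z g] /= eX eZ; subst Z X'.
rewrite /luncurry /lcurry aid_acomp; last by bd.
rewrite -acompA; [|bd|bd].
have := exchange (Arrow h) (Arrow g); rewrite /=; flat=> <-.
rewrite acompA; [|bd|bd].
rewrite -acomp_aid; last by bd.
by rewrite sA -aid_tens acomp_idl.
Qed.

Lemma rcurryK (M : strict_monoidal) (A B X Y : M) (h : hom munit (A ⊗ B))
  (e : hom (B ⊗ A) munit) (f : arrow M) : snake h e ->
  adom f = X ⊗ A -> acod f = Y -> runcurry e Y (rcurry h X f) = f.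
Proof.
case=> sA _; case: f => [Z Y' f] /= eZ eY; subst Z Y'.
rewrite /runcurry /rcurry acomp_aid; last by bd.
rewrite acompA; [|bd|bd].
have := exchange (Arrow f) (Arrow e); rewrite /=; flat=> <-.
rewrite -acompA; [|bd|bd].
rewrite -!atensA -aid_acomp; last by bd.
by rewrite sA -aid_tens acomp_idr.
Qed.

Lemma runcurryK (M : strict_monoidal) (A B X Y : M) (h : hom munit (A ⊗ B))
  (e : hom (B ⊗ A) munit) (g : arrow M) : snake h e ->
  adom g = X -> acod g = Y ⊗ B -> rcurry h X (runcurry e Y g) = g.
Proof.
case=> _ sB; case: g => [X' Z g] /= eX eZ; subst Z X'.
rewrite /runcurry /rcurry acomp_aid; last by bd.
rewrite -acompA; [|bd|bd].
have := exchange (Arrow g) (Arrow h); rewrite /=; flat=> ->.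
rewrite acompA; [|bd|bd].
rewrite -!atensA -aid_acomp; last by bd.
by rewrite sB -aid_tens acomp_idl.
Qed.

Lemma pivotal_snake (M : strict_monoidal) (P Q : M) (pp : pivotal_pair P Q) :
  snake (coev pp) (ev pp) /\ snake (ucoev pp) (uev pp).
Proof.
have h1 := ev_coev_P pp; have h2 := ev_coev_Q pp.
have h3 := uev_ucoev_P pp; have h4 := uev_ucoev_Q pp.
by move: h1 h2 h3 h4; to_arrow.
Qed.

(** Applying b and then a, with the last wire on the right created by a cup, is
    the transpose of a composite: opening the transpose of a leaves the two curried
    morphisms next to each other. *)
Lemma double_action_l (M : strict_monoidal) (A B X : M) (h : hom munit (A ⊗ B))
  (e : hom (B ⊗ A) munit) (h' : hom munit (B ⊗ A))
  (a : hom (B ⊗ X ⊗ A) X) (b : hom (A ⊗ X ⊗ B) X) : snake h e ->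
  acomp (acomp (Arrow a) (atens (atens (aid B) (Arrow b)) (aid A)))
    (atens (aid (B ⊗ A ⊗ X)) (Arrow h')) =
  luncurry e X (acomp (lcurry h (X ⊗ A) (Arrow a)) (rcurry h' (A ⊗ X) (Arrow b))).
Proof.
move=> sn; rewrite -acompA; [|bd|bd].
rewrite -[in LHS](@lcurryK _ _ _ (X ⊗ A) X h e (Arrow a)) //; last by bd.
rewrite /luncurry aid_acomp; last by bd.
rewrite -[LHS]acompA; [|bd|bd].
congr acomp; congr acomp.
rewrite /rcurry aid_acomp; last by bd.
by flat.
Qed.

Lemma double_action_r (M : strict_monoidal) (A B X : M) (h : hom munit (A ⊗ B))
  (e : hom (B ⊗ A) munit) (h' : hom munit (B ⊗ A))
  (a : hom (B ⊗ X ⊗ A) X) (b : hom (A ⊗ X ⊗ B) X) : snake h e ->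
  acomp (acomp (Arrow a) (atens (atens (aid B) (Arrow b)) (aid A)))
    (atens (Arrow h') (aid (X ⊗ B ⊗ A))) =
  runcurry e X (acomp (rcurry h (B ⊗ X) (Arrow a)) (lcurry h' (X ⊗ B) (Arrow b))).
Proof.
move=> sn; rewrite -acompA; [|bd|bd].
rewrite -[in LHS](@rcurryK _ _ _ (B ⊗ X) X h e (Arrow a)) //.
rewrite /runcurry acomp_aid; last by bd.
rewrite -[LHS]acompA; [|bd|bd].
congr acomp; congr acomp.
rewrite /lcurry acomp_aid; last by bd.
by flat.
Qed.

Lemma luncurry_aid (M : strict_monoidal) (A B X : M) (e : hom (B ⊗ A) munit) :
  luncurry e X (aid (A ⊗ X)) = atens (Arrow e) (aid X).
Proof. by rewrite /luncurry -aid_tens acomp_idr //=; strict_ob. Qed.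

Lemma runcurry_aid (M : strict_monoidal) (A B X : M) (e : hom (B ⊗ A) munit) :
  runcurry e X (aid (X ⊗ B)) = atens (aid X) (Arrow e).
Proof. by rewrite /runcurry -aid_tens acomp_idr //=; strict_ob. Qed.

(** * Objects of C(P,Q) as actions of F_+ and F_- *)

(** Taking both operations as one function of the sign makes the four equations
    instances of a single one. *)
Definition is_action (M : strict_monoidal) (P Q : M) (pp : pivotal_pair P Q) (X : M)
    (act : forall i, hom (Fsign P Q i X) X) : Prop :=
  forall k, act (rel_outer k) ∘ fmap (Fsign P Q (rel_outer k)) (act (rel_inner k))
    ∘ rel_expand_at pp k X = rel_contract_at pp k X.

(** The half braiding σ obtained from a; [act_sig_inv] gives σ⁻¹ from b, and [sig_act],
    [sig_inv_act] go back. *)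
Definition act_sig (M : strict_monoidal) (P Q : M) (pp : pivotal_pair P Q) (X : M)
    (a : hom (Fsign P Q plus X) X) : hom (X ⊗ P) (P ⊗ X) :=
  ⌈ (P ◁ (a : hom (Q ⊗ X ⊗ P) X)) ⊙ (coev pp ▷ X ▷ P) ⌉.

Definition act_sig_inv (M : strict_monoidal) (P Q : M) (pp : pivotal_pair P Q) (X : M)
    (b : hom (Fsign P Q minus X) X) : hom (P ⊗ X) (X ⊗ P) :=
  ⌈ ((b : hom (P ⊗ X ⊗ Q) X) ▷ P) ⊙ ((P ⊗ X) ◁ ucoev pp) ⌉.

Definition sig_act (M : strict_monoidal) (P Q : M) (pp : pivotal_pair P Q) (X : M)
    (s : hom (X ⊗ P) (P ⊗ X)) : hom (Fsign P Q plus X) X :=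
  (⌈ (ev pp ▷ X) ⊙ (Q ◁ s) ⌉ : hom (Q ⊗ X ⊗ P) X).

Definition sig_inv_act (M : strict_monoidal) (P Q : M) (pp : pivotal_pair P Q) (X : M)
    (t : hom (P ⊗ X) (X ⊗ P)) : hom (Fsign P Q minus X) X :=
  (⌈ (X ◁ uev pp) ⊙ (t ▷ Q) ⌉ : hom (P ⊗ X ⊗ Q) X).

Lemma act_sigE (M : strict_monoidal) (P Q : M) (pp : pivotal_pair P Q) (X : M)
  (a : hom (Fsign P Q plus X) X) :
  Arrow (act_sig pp a) = lcurry (coev pp) (X ⊗ P) (Arrow a).
Proof. by rewrite /act_sig /lcurry; to_arrow; flat. Qed.

Lemma act_sig_invE (M : strict_monoidal) (P Q : M) (pp : pivotal_pair P Q) (X : M)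
  (b : hom (Fsign P Q minus X) X) :
  Arrow (act_sig_inv pp b) = rcurry (ucoev pp) (P ⊗ X) (Arrow b).
Proof. by rewrite /act_sig_inv /rcurry; to_arrow; flat. Qed.

Lemma sig_actE (M : strict_monoidal) (P Q : M) (pp : pivotal_pair P Q) (X : M)
  (s : hom (X ⊗ P) (P ⊗ X)) : Arrow (sig_act pp s) = luncurry (ev pp) X (Arrow s).
Proof. by rewrite /sig_act /luncurry; to_arrow. Qed.

Lemma sig_actK (M : strict_monoidal) (P Q : M) (pp : pivotal_pair P Q) (X : M)
  (s : hom (X ⊗ P) (P ⊗ X)) : act_sig pp (sig_act pp s) = s.
Proof.
have [sn _] := pivotal_snake pp.
by apply: arrow_inj; rewrite act_sigE sig_actE (luncurryK sn).
Qed.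

Lemma act_sigK (M : strict_monoidal) (P Q : M) (pp : pivotal_pair P Q) (X : M)
  (a : hom (Fsign P Q plus X) X) : sig_act pp (act_sig pp a) = a.
Proof.
have [sn _] := pivotal_snake pp.
by apply: arrow_inj; rewrite sig_actE act_sigE (lcurryK sn) //=; strict_ob.
Qed.

(** The mate bends both wires P of s, and bending only the left one gives a. *)
Lemma mateE (M : strict_monoidal) (P Q : M) (pp : pivotal_pair P Q) (X : M)
  (s : hom (X ⊗ P) (P ⊗ X)) :
  Arrow (mate pp s) = rcurry (coev pp) (Q ⊗ X) (luncurry (ev pp) X (Arrow s)).
Proof.
rewrite mate_arrow /rcurry /luncurry [in RHS]acomp_aid; last by bd.
by rewrite acompA; [flat|bd|bd].
Qed.

Lemma comateE (M : strict_monoidal) (P Q : M) (pp : pivotal_pair P Q) (X : M)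
  (t : hom (P ⊗ X) (X ⊗ P)) :
  Arrow (comate pp t) = lcurry (ucoev pp) (X ⊗ Q) (runcurry (uev pp) X (Arrow t)).
Proof.
rewrite comate_arrow /lcurry /runcurry [in RHS]aid_acomp; last by bd.
by rewrite acompA; [flat|bd|bd].
Qed.

Lemma luncurry_inj (M : strict_monoidal) (A B Y : M) (h : hom munit (A ⊗ B))
  (e : hom (B ⊗ A) munit) (g g' : arrow M) : snake h e ->
  adom g = adom g' -> acod g = A ⊗ Y -> acod g' = A ⊗ Y ->
  luncurry e Y g = luncurry e Y g' -> g = g'.
Proof.
move=> sn e1 e2 e3 eq.
by rewrite -(luncurryK sn e1 e2) eq luncurryK.
Qed.

Lemma runcurry_inj (M : strict_monoidal) (A B Y : M) (h : hom munit (A ⊗ B))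
  (e : hom (B ⊗ A) munit) (g g' : arrow M) : snake h e ->
  adom g = adom g' -> acod g = Y ⊗ B -> acod g' = Y ⊗ B ->
  runcurry e Y g = runcurry e Y g' -> g = g'.
Proof.
move=> sn e1 e2 e3 eq.
by rewrite -(runcurryK sn e1 e2) eq runcurryK.
Qed.

Lemma mate_act_sig (M : strict_monoidal) (P Q : M) (pp : pivotal_pair P Q) (X : M)
  (a : hom (Fsign P Q plus X) X) :
  Arrow (mate pp (act_sig pp a)) = rcurry (coev pp) (Q ⊗ X) (Arrow a).
Proof.
have [sn _] := pivotal_snake pp.
by rewrite mateE act_sigE (lcurryK sn) //=; strict_ob.
Qed.

Lemma comate_act_sig_inv (M : strict_monoidal) (P Q : M) (pp : pivotal_pair P Q) (X : M)
  (b : hom (Fsign P Q minus X) X) :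
  Arrow (comate pp (act_sig_inv pp b)) = lcurry (ucoev pp) (X ⊗ Q) (Arrow b).
Proof.
have [_ sn] := pivotal_snake pp.
by rewrite comateE act_sig_invE (rcurryK sn).
Qed.

(** Each of the four equations is the image, under an injective transposition, of one
    of the four equations saying that σ, σ⁻¹ and the two mates form inverse pairs:
    [rel4] and [rel3] give the first pair, [rel1] and [rel2] the second. *)
Lemma is_actionP (M : strict_monoidal) (P Q : M) (pp : pivotal_pair P Q) (X : M)
  (act : forall i, hom (Fsign P Q i X) X) :
  is_action pp act <->
  inverse_pair (act_sig pp (act plus)) (act_sig_inv pp (act minus)) /\
  inverse_pair (mate pp (act_sig pp (act plus))) (comate pp (act_sig_inv pp (act minus))).
Proof.
have [sn sn'] := pivotal_snake pp.
rewrite !inverse_pair_arrow mate_act_sig comate_act_sig_inv act_sigE act_sig_invE.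
have h1 := double_action_l (coev pp) (act minus) (act plus) sn'.
have h2 := double_action_r (ucoev pp) (act plus) (act minus) sn.
have h3 := double_action_l (ucoev pp) (act plus) (act minus) sn.
have h4 := double_action_r (coev pp) (act minus) (act plus) sn'.
have Er k : (act (rel_outer k) ∘ fmap (Fsign P Q (rel_outer k)) (act (rel_inner k))
    ∘ rel_expand_at pp k X = rel_contract_at pp k X) <->
  match k with
  | rel1 => luncurry (uev pp) X (acomp (lcurry (ucoev pp) (X ⊗ Q) (Arrow (act minus)))
         (rcurry (coev pp) (Q ⊗ X) (Arrow (act plus)))) = luncurry (uev pp) X (aid (Q ⊗ X))
  | rel2 => runcurry (ev pp) X (acomp (rcurry (coev pp) (Q ⊗ X) (Arrow (act plus)))
         (lcurry (ucoev pp) (X ⊗ Q) (Arrow (act minus)))) = runcurry (ev pp) X (aid (X ⊗ Q))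
  | rel3 => luncurry (ev pp) X (acomp (lcurry (coev pp) (X ⊗ P) (Arrow (act plus)))
         (rcurry (ucoev pp) (P ⊗ X) (Arrow (act minus)))) = luncurry (ev pp) X (aid (P ⊗ X))
  | rel4 => runcurry (uev pp) X (acomp (rcurry (ucoev pp) (P ⊗ X) (Arrow (act minus)))
         (lcurry (coev pp) (X ⊗ P) (Arrow (act plus)))) = runcurry (uev pp) X (aid (X ⊗ P))
  end.
  case: k; rewrite ?luncurry_aid ?runcurry_aid -?(h1, h2, h3, h4);
    (split=> [/(f_equal (@Arrow _ _ _))|e]; last apply: arrow_inj; last move: e);
    by rewrite /=; to_arrow.
split=> [h|[[e4 e3] [e1 e2]] k]; last first.
  by apply/Er; case: k; rewrite ?e1 ?e2 ?e3 ?e4.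
split; split.
- by apply: (runcurry_inj sn' _ _ _ (proj1 (Er _) (h rel4))); bd.
- by apply: (luncurry_inj sn _ _ _ (proj1 (Er _) (h rel3))); bd.
- by apply: (luncurry_inj sn' _ _ _ (proj1 (Er _) (h rel1))); bd.
- by apply: (runcurry_inj sn _ _ _ (proj1 (Er _) (h rel2))); bd.
Qed.

Lemma pq_cond_action (M : strict_monoidal) (P Q : M) (pp : pivotal_pair P Q) (X : M)
  (s : hom (X ⊗ P) (P ⊗ X)) : pq_cond pp s ->
  exists act : forall i, hom (Fsign P Q i X) X,
    is_action pp act /\ act_sig pp (act plus) = s.
Proof.
move=> [t [h1 h2]]; have [_ sn'] := pivotal_snake pp.
pose act i : hom (Fsign P Q i X) X :=
  match i return hom (Fsign P Q i X) X with
  | plus => sig_act pp s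
  | minus => sig_inv_act pp t
  end.
have eb : Arrow (sig_inv_act pp t) = runcurry (uev pp) X (Arrow t).
  by rewrite /sig_inv_act /runcurry; to_arrow.
have es : act_sig pp (act plus) = s by apply: sig_actK.
have et : act_sig_inv pp (act minus) = t.
  by apply: arrow_inj; rewrite act_sig_invE eb (runcurryK sn').
by exists act; split=> //; apply/is_actionP; rewrite es et.
Qed.

Lemma action_pq_cond (M : strict_monoidal) (P Q : M) (pp : pivotal_pair P Q) (X : M)
  (act : forall i, hom (Fsign P Q i X) X) :
  is_action pp act -> pq_cond pp (act_sig pp (act plus)).
Proof. by move/is_actionP=> h; exists (act_sig_inv pp (act minus)). Qed.

(** * Morphisms of C(P,Q) as morphisms of actions *)

Lemma lcurry_post (M : strict_monoidal) (A B X Y : M) (h : hom munit (A ⊗ B))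
  (f g : arrow M) : adom g = B ⊗ X -> acod g = adom f ->
  lcurry h X (acomp f g) = acomp (atens (aid A) f) (lcurry h X g).
Proof.
case: f => [? ? f]; case: g => [? ? g] /= e1 e2; subst.
rewrite /lcurry aid_acomp // acompA //; bd.
Qed.

Lemma lcurry_pre (M : strict_monoidal) (A B : M) (h : hom munit (A ⊗ B))
  (g k : arrow M) : adom g = B ⊗ acod k ->
  lcurry h (adom k) (acomp g (atens (aid B) k)) = acomp (lcurry h (acod k) g) k.
Proof.
case: k => [X X' k]; case: g => [? ? g] /= e1; subst.
rewrite /lcurry aid_acomp // -[RHS]acompA; [|bd|bd].
have := exchange (Arrow h) (Arrow k); rewrite /=; flat=> ->.
by rewrite -acompA //; bd.
Qed.

Lemma rcurry_post (M : strict_monoidal) (A B X : M) (h : hom munit (A ⊗ B))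
  (f g : arrow M) : adom g = X ⊗ A -> acod g = adom f ->
  rcurry h X (acomp f g) = acomp (atens f (aid B)) (rcurry h X g).
Proof.
case: f => [? ? f]; case: g => [? ? g] /= e1 e2; subst.
rewrite /rcurry acomp_aid // acompA //; bd.
Qed.

Lemma rcurry_pre (M : strict_monoidal) (A B : M) (h : hom munit (A ⊗ B))
  (g k : arrow M) : adom g = acod k ⊗ A ->
  rcurry h (adom k) (acomp g (atens k (aid A))) = acomp (rcurry h (acod k) g) k.
Proof.
case: k => [X X' k]; case: g => [? ? g] /= e1; subst.
rewrite /rcurry acomp_aid // -[RHS]acompA; [|bd|bd].
have := exchange (Arrow k) (Arrow h); rewrite /=; flat=> <-.
by rewrite -acompA //; bd.
Qed.

Lemma act_sig_hom (M : strict_monoidal) (P Q : M) (pp : pivotal_pair P Q) (X Y : M)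
  (f : hom X Y) (a : hom (Fsign P Q plus X) X) (a' : hom (Fsign P Q plus Y) Y) :
  act_sig pp a' ∘ (f ▷ P) = (P ◁ f) ∘ act_sig pp a <->
  f ∘ a = a' ∘ fmap (Fsign P Q plus) f.
Proof.
have [sn _] := pivotal_snake pp.
have e1 : Arrow (act_sig pp a' ∘ (f ▷ P)) =
    lcurry (coev pp) (X ⊗ P) (Arrow (a' ∘ fmap (Fsign P Q plus) f)).
  have := @lcurry_pre _ _ _ (coev pp) (Arrow a') (Arrow (f ▷ P)).
  by rewrite comp_arrow act_sigE /=; to_arrow; flat=> -> //; strict_ob.
have e2 : Arrow ((P ◁ f) ∘ act_sig pp a) = lcurry (coev pp) (X ⊗ P) (Arrow (f ∘ a)).
  rewrite !comp_arrow act_sigE lcurry_post //=; strict_ob.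
split=> [e|e]; apply: arrow_inj; last by rewrite e1 e2 e.
have {}e1 := f_equal (luncurry (ev pp) Y) e1.
have {}e2 := f_equal (luncurry (ev pp) Y) e2.
move: e1 e2; rewrite !(lcurryK sn) //=; try strict_ob.
by move=> <- <-; rewrite e.
Qed.

Lemma act_sig_inv_hom (M : strict_monoidal) (P Q : M) (pp : pivotal_pair P Q) (X Y : M)
  (f : hom X Y) (b : hom (Fsign P Q minus X) X) (b' : hom (Fsign P Q minus Y) Y) :
  act_sig_inv pp b' ∘ (P ◁ f) = (f ▷ P) ∘ act_sig_inv pp b ->
  f ∘ b = b' ∘ fmap (Fsign P Q minus) f.
Proof.
have [_ sn] := pivotal_snake pp.
have e1 : Arrow (act_sig_inv pp b' ∘ (P ◁ f)) =
    rcurry (ucoev pp) (P ⊗ X) (Arrow (b' ∘ fmap (Fsign P Q minus) f)).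
  have := @rcurry_pre _ _ _ (ucoev pp) (Arrow b') (Arrow (P ◁ f)).
  by rewrite comp_arrow act_sig_invE /=; to_arrow; flat=> -> //; strict_ob.
have e2 : Arrow ((f ▷ P) ∘ act_sig_inv pp b) = rcurry (ucoev pp) (P ⊗ X) (Arrow (f ∘ b)).
  rewrite !comp_arrow act_sig_invE rcurry_post //=; strict_ob.
move=> e; apply: arrow_inj.
have {}e1 := f_equal (runcurry (uev pp) Y) e1.
have {}e2 := f_equal (runcurry (uev pp) Y) e2.
move: e1 e2; rewrite !(rcurryK sn) //=; try strict_ob.
by move=> <- <-; rewrite e.
Qed.

(** Commuting with a means commuting with σ, hence with σ⁻¹, hence with b. *)
Lemma action_hom (M : strict_monoidal) (P Q : M) (pp : pivotal_pair P Q) (X Y : M)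
  (act : forall i, hom (Fsign P Q i X) X) (act' : forall i, hom (Fsign P Q i Y) Y)
  (f : hom X Y) : is_action pp act -> is_action pp act' ->
  f ∘ act plus = act' plus ∘ fmap (Fsign P Q plus) f ->
  forall i, f ∘ act i = act' i ∘ fmap (Fsign P Q i) f.
Proof.
move=> /is_actionP [[_ h] _] /is_actionP [[h' _] _] /(act_sig_hom pp) e [].
  exact/(act_sig_hom pp).
apply: (@act_sig_inv_hom _ _ _ pp).
by rewrite -[LHS]comp_idr -h comp_assoc -(comp_assoc _ (P ◁ f)) -e comp_assoc h' comp_idl.
Qed.

(** * Moving cups and caps through an object of C(P,Q) *)

(** Both sides are a itself, uncurried from its right and from its left transpose. *)
Lemma slide_cap (M : strict_monoidal) (A B X : M) (h : hom munit (A ⊗ B))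
  (e : hom (B ⊗ A) munit) (a : hom (B ⊗ X ⊗ A) X) : snake h e ->
  acomp (atens (aid X) (Arrow e)) (atens (rcurry h (B ⊗ X) (Arrow a)) (aid A)) =
  acomp (atens (Arrow e) (aid X)) (atens (aid B) (lcurry h (X ⊗ A) (Arrow a))).
Proof.
move=> sn; rewrite -[LHS]/(runcurry e X _) -[RHS]/(luncurry e X _).
by rewrite (rcurryK sn) // (lcurryK sn) //=; strict_ob.
Qed.

(** Both sides are a with cups on its two outer wires; the order in which the two cups
    are created is irrelevant by the interchange law. *)
Lemma slide_cup (M : strict_monoidal) (A B X : M) (h : hom munit (A ⊗ B))
  (a : hom (B ⊗ X ⊗ A) X) :
  acomp (atens (aid A) (rcurry h (B ⊗ X) (Arrow a))) (atens (Arrow h) (aid X)) =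
  acomp (atens (lcurry h (X ⊗ A) (Arrow a)) (aid B)) (atens (aid X) (Arrow h)).
Proof.
rewrite /rcurry /lcurry aid_acomp; last by bd.
rewrite acomp_aid; last by bd.
rewrite -!acompA; try by bd.
have := exchange (Arrow h) (atens (aid X) (Arrow h)); rewrite /=; flat=> ->.
by [].
Qed.

(** With b and a forming an inverse pair, a cup created to the left of X can be dragged
    across X. The next three lemmas are its reflections, left-right and up-down. *)
Lemma cup_pass_r (M : strict_monoidal) (A B X : M) (h : hom munit (A ⊗ B))
  (h' : hom munit (B ⊗ A)) (a : hom (B ⊗ X ⊗ A) X) (b : hom (A ⊗ X ⊗ B) X) :
  acomp (rcurry h' (A ⊗ X) (Arrow b)) (lcurry h (X ⊗ A) (Arrow a)) = aid (X ⊗ A) ->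
  acomp (acomp (atens (rcurry h' (A ⊗ X) (Arrow b)) (aid B))
      (atens (aid A) (rcurry h (B ⊗ X) (Arrow a)))) (atens (Arrow h) (aid X)) =
  atens (aid X) (Arrow h).
Proof.
move=> ts; rewrite -acompA; [|bd|bd].
rewrite slide_cup acompA; [|bd|bd].
rewrite -acomp_aid; last by bd.
by rewrite ts -aid_tens acomp_idl //; bd.
Qed.

Lemma cup_pass_l (M : strict_monoidal) (A B X : M) (h : hom munit (A ⊗ B))
  (h' : hom munit (B ⊗ A)) (a : hom (B ⊗ X ⊗ A) X) (b : hom (A ⊗ X ⊗ B) X) :
  acomp (lcurry h' (X ⊗ B) (Arrow b)) (rcurry h (B ⊗ X) (Arrow a)) = aid (B ⊗ X) ->
  acomp (acomp (atens (aid A) (lcurry h' (X ⊗ B) (Arrow b)))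
      (atens (lcurry h (X ⊗ A) (Arrow a)) (aid B))) (atens (aid X) (Arrow h)) =
  atens (Arrow h) (aid X).
Proof.
move=> nm; rewrite -acompA; [|bd|bd].
rewrite -slide_cup acompA; [|bd|bd].
rewrite -aid_acomp; last by bd.
by rewrite nm -aid_tens acomp_idl //; bd.
Qed.

Lemma cap_pass_r (M : strict_monoidal) (A B X : M) (h : hom munit (A ⊗ B))
  (e : hom (B ⊗ A) munit) (h' : hom munit (B ⊗ A))
  (a : hom (B ⊗ X ⊗ A) X) (b : hom (A ⊗ X ⊗ B) X) : snake h e ->
  acomp (lcurry h (X ⊗ A) (Arrow a)) (rcurry h' (A ⊗ X) (Arrow b)) = aid (A ⊗ X) ->
  acomp (atens (aid X) (Arrow e)) (acomp (atens (rcurry h (B ⊗ X) (Arrow a)) (aid A))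
      (atens (aid B) (rcurry h' (A ⊗ X) (Arrow b)))) =
  atens (Arrow e) (aid X).
Proof.
move=> sn st; rewrite acompA; [|bd|bd].
rewrite (slide_cap _ sn) -acompA; [|bd|bd].
rewrite -aid_acomp; last by bd.
by rewrite st -aid_tens acomp_idr //; bd.
Qed.

Lemma cap_pass_l (M : strict_monoidal) (A B X : M) (h : hom munit (A ⊗ B))
  (e : hom (B ⊗ A) munit) (h' : hom munit (B ⊗ A))
  (a : hom (B ⊗ X ⊗ A) X) (b : hom (A ⊗ X ⊗ B) X) : snake h e ->
  acomp (rcurry h (B ⊗ X) (Arrow a)) (lcurry h' (X ⊗ B) (Arrow b)) = aid (X ⊗ B) ->
  acomp (atens (Arrow e) (aid X)) (acomp (atens (aid B) (lcurry h (X ⊗ A) (Arrow a)))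
      (atens (lcurry h' (X ⊗ B) (Arrow b)) (aid A))) =
  atens (aid X) (Arrow e).
Proof.
move=> sn mn; rewrite acompA; [|bd|bd].
rewrite -(slide_cap _ sn) -acompA; [|bd|bd].
rewrite -acomp_aid; last by bd.
by rewrite mn -aid_tens acomp_idr //; bd.
Qed.

(** The analogue of a distributive law of F_+, F_- over G. The component [al_src] makes
    the four equations evaluated at G H correspond to G applied to the equations at H. *)
Record action_law (M : strict_monoidal) (P Q : M) (pp : pivotal_pair P Q)
    (G : functor M M) : Type := ActionLaw {
  al_swap : forall i H, hom (G (Fsign P Q i H)) (Fsign P Q i (G H));
  al_swap_nat : forall i (H H' : M) (f : hom H H'),
    al_swap i H' ∘ fmap G (fmap (Fsign P Q i) f) =
    fmap (Fsign P Q i) (fmap G f) ∘ al_swap i H;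
  al_src : forall k H, hom (G (rel_src P Q k H)) (rel_src P Q k (G H));
  al_expand : forall k H,
    fmap (Fsign P Q (rel_outer k)) (al_swap (rel_inner k) H) ∘ al_swap (rel_outer k) _
      ∘ fmap G (rel_expand_at pp k H) = rel_expand_at pp k (G H) ∘ al_src k H;
  al_contract : forall k H,
    fmap G (rel_contract_at pp k H) = rel_contract_at pp k (G H) ∘ al_src k H }.

Lemma exchange_ob (M : strict_monoidal) (a b : arrow M) (A A' B B' : M) :
  adom a = A -> acod a = A' -> adom b = B -> acod b = B' ->
  acomp (atens a (aid B')) (atens (aid A) b) = acomp (atens (aid A') b) (atens a (aid B)).
Proof. by move=> <- <- <- <-; apply: exchange. Qed.

(** Only the moving of P and of Q past X enters, so t and m stand for σ⁻¹ and the mate of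
    σ but are left arbitrary; in [swap_l], s and n stand for σ and the comate of σ⁻¹. *)
Definition swap_r (M : strict_monoidal) (P Q X : M)
    (t : hom (P ⊗ X) (X ⊗ P)) (m : hom (Q ⊗ X) (X ⊗ Q)) (i : sign) (H : M) :
    hom (Fsign P Q i H ⊗ X) (Fsign P Q i (H ⊗ X)) :=
  match i return hom (Fsign P Q i H ⊗ X) (Fsign P Q i (H ⊗ X)) with
  | plus => (⌈ (Q ⊗ H) ◁ t ⌉ : hom (Q ⊗ H ⊗ P ⊗ X) (Q ⊗ (H ⊗ X) ⊗ P))
  | minus => (⌈ (P ⊗ H) ◁ m ⌉ : hom (P ⊗ H ⊗ Q ⊗ X) (P ⊗ (H ⊗ X) ⊗ Q))
  end.

Definition swap_src_r (M : strict_monoidal) (P Q X : M)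
    (t : hom (P ⊗ X) (X ⊗ P)) (m : hom (Q ⊗ X) (X ⊗ Q)) (k : rel_kind) (H : M) :
    hom (rel_src P Q k H ⊗ X) (rel_src P Q k (H ⊗ X)) :=
  match k return hom (rel_src P Q k H ⊗ X) (rel_src P Q k (H ⊗ X)) with
  | rel1 => (⌈ idm (P ⊗ Q ⊗ H ⊗ X) ⌉ : hom (P ⊗ Q ⊗ H ⊗ X) (P ⊗ Q ⊗ (H ⊗ X)))
  | rel2 => (⌈ H ◁ ((m ▷ P) ⊙ (Q ◁ t)) ⌉ : hom (H ⊗ (Q ⊗ P) ⊗ X) (H ⊗ X ⊗ (Q ⊗ P)))
  | rel3 => (⌈ idm (Q ⊗ P ⊗ H ⊗ X) ⌉ : hom (Q ⊗ P ⊗ H ⊗ X) (Q ⊗ P ⊗ (H ⊗ X)))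
  | rel4 => (⌈ H ◁ ((t ▷ Q) ⊙ (P ◁ m)) ⌉ : hom (H ⊗ (P ⊗ Q) ⊗ X) (H ⊗ X ⊗ (P ⊗ Q)))
  end.

Lemma swap_r_nat (M : strict_monoidal) (P Q X : M)
  (t : hom (P ⊗ X) (X ⊗ P)) (m : hom (Q ⊗ X) (X ⊗ Q)) (i : sign) (H H' : M) (f : hom H H') :
  swap_r t m i H' ∘ (fmap (Fsign P Q i) f ▷ X) =
  fmap (Fsign P Q i) (f ▷ X) ∘ swap_r t m i H.
Proof.
apply: arrow_inj; case: i => /=; to_arrow.
- have := exchange (atens (aid Q) (Arrow f)) (Arrow t).
  by rewrite /=; flat=> ->.
- have := exchange (atens (aid P) (Arrow f)) (Arrow m).
  by rewrite /=; flat=> ->.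
Qed.

Lemma swap_r_expand (M : strict_monoidal) (P Q : M) (pp : pivotal_pair P Q) (X : M)
  (t : hom (P ⊗ X) (X ⊗ P)) (m : hom (Q ⊗ X) (X ⊗ Q)) (k : rel_kind) (H : M) :
  acomp (acomp (atens (Arrow t) (aid Q)) (atens (aid P) (Arrow m)))
    (atens (Arrow (coev pp)) (aid X)) = atens (aid X) (Arrow (coev pp)) ->
  acomp (acomp (atens (Arrow m) (aid P)) (atens (aid Q) (Arrow t)))
    (atens (Arrow (ucoev pp)) (aid X)) = atens (aid X) (Arrow (ucoev pp)) ->
  fmap (Fsign P Q (rel_outer k)) (swap_r t m (rel_inner k) H)
    ∘ swap_r t m (rel_outer k) (Fsign P Q (rel_inner k) H) ∘ (rel_expand_at pp k H ▷ X) =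
  rel_expand_at pp k (H ⊗ X) ∘ swap_src_r t m k H.
Proof.
move=> cup cup'; apply: arrow_inj; case: k => /=; to_arrow; flat.
- have := f_equal (atens (aid (P ⊗ Q ⊗ H))) cup.
  rewrite aid_acomp; [|bd]; rewrite aid_acomp; [|bd]; flat=> ->.
  by rewrite -!aid_tens acomp_idr //=; strict_ob.
- have := @exchange_ob _ (Arrow (ucoev pp)) (atens (aid H)
    (acomp (atens (Arrow m) (aid P)) (atens (aid Q) (Arrow t))))
    munit (Q ⊗ P) (H ⊗ Q ⊗ P ⊗ X) (H ⊗ X ⊗ Q ⊗ P).
  flat=> ->; try bd; congr acomp.
  by rewrite -!aid_tens aid_acomp; [flat|bd].
- have := f_equal (atens (aid (Q ⊗ P ⊗ H))) cup'.
  rewrite aid_acomp; [|bd]; rewrite aid_acomp; [|bd]; flat=> ->.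
  by rewrite -!aid_tens acomp_idr //=; strict_ob.
- have := @exchange_ob _ (Arrow (coev pp)) (atens (aid H)
    (acomp (atens (Arrow t) (aid Q)) (atens (aid P) (Arrow m))))
    munit (P ⊗ Q) (H ⊗ P ⊗ Q ⊗ X) (H ⊗ X ⊗ P ⊗ Q).
  flat=> ->; try bd; congr acomp.
  by rewrite -!aid_tens aid_acomp; [flat|bd].
Qed.

Lemma swap_r_contract (M : strict_monoidal) (P Q : M) (pp : pivotal_pair P Q) (X : M)
  (t : hom (P ⊗ X) (X ⊗ P)) (m : hom (Q ⊗ X) (X ⊗ Q)) (k : rel_kind) (H : M) :
  acomp (atens (aid X) (Arrow (ev pp)))
    (acomp (atens (Arrow m) (aid P)) (atens (aid Q) (Arrow t))) =
    atens (Arrow (ev pp)) (aid X) ->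
  acomp (atens (aid X) (Arrow (uev pp)))
    (acomp (atens (Arrow t) (aid Q)) (atens (aid P) (Arrow m))) =
    atens (Arrow (uev pp)) (aid X) ->
  rel_contract_at pp k H ▷ X = rel_contract_at pp k (H ⊗ X) ∘ swap_src_r t m k H.
Proof.
move=> cap cap'; apply: arrow_inj; case: k => /=; to_arrow; flat.
- by rewrite -!aid_tens acomp_idr //=; strict_ob.
- by have := f_equal (atens (aid H)) cap; rewrite aid_acomp; [flat=> ->|bd].
- by rewrite -!aid_tens acomp_idr //=; strict_ob.
- by have := f_equal (atens (aid H)) cap'; rewrite aid_acomp; [flat=> ->|bd].
Qed.

Definition swap_l (M : strict_monoidal) (P Q X : M)
    (s : hom (X ⊗ P) (P ⊗ X)) (n : hom (X ⊗ Q) (Q ⊗ X)) (i : sign) (H : M) :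
    hom (X ⊗ Fsign P Q i H) (Fsign P Q i (X ⊗ H)) :=
  match i return hom (X ⊗ Fsign P Q i H) (Fsign P Q i (X ⊗ H)) with
  | plus => (⌈ n ▷ (H ⊗ P) ⌉ : hom (X ⊗ (Q ⊗ H ⊗ P)) (Q ⊗ (X ⊗ H) ⊗ P))
  | minus => (⌈ s ▷ (H ⊗ Q) ⌉ : hom (X ⊗ (P ⊗ H ⊗ Q)) (P ⊗ (X ⊗ H) ⊗ Q))
  end.

Definition swap_src_l (M : strict_monoidal) (P Q X : M)
    (s : hom (X ⊗ P) (P ⊗ X)) (n : hom (X ⊗ Q) (Q ⊗ X)) (k : rel_kind) (H : M) :
    hom (X ⊗ rel_src P Q k H) (rel_src P Q k (X ⊗ H)) :=
  match k return hom (X ⊗ rel_src P Q k H) (rel_src P Q k (X ⊗ H)) with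
  | rel1 => (⌈ ((P ◁ n) ⊙ (s ▷ Q)) ▷ H ⌉ : hom (X ⊗ (P ⊗ Q ⊗ H)) (P ⊗ Q ⊗ (X ⊗ H)))
  | rel2 => (⌈ idm (X ⊗ H ⊗ (Q ⊗ P)) ⌉ : hom (X ⊗ (H ⊗ (Q ⊗ P))) (X ⊗ H ⊗ (Q ⊗ P)))
  | rel3 => (⌈ ((Q ◁ s) ⊙ (n ▷ P)) ▷ H ⌉ : hom (X ⊗ (Q ⊗ P ⊗ H)) (Q ⊗ P ⊗ (X ⊗ H)))
  | rel4 => (⌈ idm (X ⊗ H ⊗ (P ⊗ Q)) ⌉ : hom (X ⊗ (H ⊗ (P ⊗ Q))) (X ⊗ H ⊗ (P ⊗ Q)))
  end.

Lemma swap_l_nat (M : strict_monoidal) (P Q X : M)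
  (s : hom (X ⊗ P) (P ⊗ X)) (n : hom (X ⊗ Q) (Q ⊗ X)) (i : sign) (H H' : M) (f : hom H H') :
  swap_l s n i H' ∘ (X ◁ fmap (Fsign P Q i) f) =
  fmap (Fsign P Q i) (X ◁ f) ∘ swap_l s n i H.
Proof.
apply: arrow_inj; case: i => /=; to_arrow.
- have := exchange (Arrow n) (atens (Arrow f) (aid P)).
  by rewrite /=; flat=> ->.
- have := exchange (Arrow s) (atens (Arrow f) (aid Q)).
  by rewrite /=; flat=> ->.
Qed.

Lemma swap_l_expand (M : strict_monoidal) (P Q : M) (pp : pivotal_pair P Q) (X : M)
  (s : hom (X ⊗ P) (P ⊗ X)) (n : hom (X ⊗ Q) (Q ⊗ X)) (k : rel_kind) (H : M) :
  acomp (acomp (atens (aid P) (Arrow n)) (atens (Arrow s) (aid Q)))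
    (atens (aid X) (Arrow (coev pp))) = atens (Arrow (coev pp)) (aid X) ->
  acomp (acomp (atens (aid Q) (Arrow s)) (atens (Arrow n) (aid P)))
    (atens (aid X) (Arrow (ucoev pp))) = atens (Arrow (ucoev pp)) (aid X) ->
  fmap (Fsign P Q (rel_outer k)) (swap_l s n (rel_inner k) H)
    ∘ swap_l s n (rel_outer k) (Fsign P Q (rel_inner k) H) ∘ (X ◁ rel_expand_at pp k H) =
  rel_expand_at pp k (X ⊗ H) ∘ swap_src_l s n k H.
Proof.
move=> cup cup'; apply: arrow_inj; case: k => /=; to_arrow; flat.
- have := @exchange_ob _ (atens
    (acomp (atens (aid P) (Arrow n)) (atens (Arrow s) (aid Q))) (aid H))
    (Arrow (coev pp)) (X ⊗ P ⊗ Q ⊗ H) (P ⊗ Q ⊗ X ⊗ H) munit (P ⊗ Q).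
  flat=> <-; try bd; congr acomp.
  by rewrite -!atensA -!aid_tens acomp_aid; [flat|bd].
- have := f_equal (fun g => atens g (aid (H ⊗ Q ⊗ P))) cup'.
  rewrite acomp_aid; [|bd]; rewrite acomp_aid; [|bd]; flat=> ->.
  by rewrite -!aid_tens acomp_idr //=; strict_ob.
- have := @exchange_ob _ (atens
    (acomp (atens (aid Q) (Arrow s)) (atens (Arrow n) (aid P))) (aid H))
    (Arrow (ucoev pp)) (X ⊗ Q ⊗ P ⊗ H) (Q ⊗ P ⊗ X ⊗ H) munit (Q ⊗ P).
  flat=> <-; try bd; congr acomp.
  by rewrite -!atensA -!aid_tens acomp_aid; [flat|bd].
- have := f_equal (fun g => atens g (aid (H ⊗ P ⊗ Q))) cup.
  rewrite acomp_aid; [|bd]; rewrite acomp_aid; [|bd]; flat=> ->.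
  by rewrite -!aid_tens acomp_idr //=; strict_ob.
Qed.

Lemma swap_l_contract (M : strict_monoidal) (P Q : M) (pp : pivotal_pair P Q) (X : M)
  (s : hom (X ⊗ P) (P ⊗ X)) (n : hom (X ⊗ Q) (Q ⊗ X)) (k : rel_kind) (H : M) :
  acomp (atens (Arrow (ev pp)) (aid X))
    (acomp (atens (aid Q) (Arrow s)) (atens (Arrow n) (aid P))) =
    atens (aid X) (Arrow (ev pp)) ->
  acomp (atens (Arrow (uev pp)) (aid X))
    (acomp (atens (aid P) (Arrow n)) (atens (Arrow s) (aid Q))) =
    atens (aid X) (Arrow (uev pp)) ->
  X ◁ rel_contract_at pp k H = rel_contract_at pp k (X ⊗ H) ∘ swap_src_l s n k H.
Proof.
move=> cap cap'; apply: arrow_inj; case: k => /=; to_arrow; flat.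
- by have := f_equal (fun g => atens g (aid H)) cap'; rewrite acomp_aid; [flat=> ->|bd].
- by rewrite -!aid_tens acomp_idr //=; strict_ob.
- by have := f_equal (fun g => atens g (aid H)) cap; rewrite acomp_aid; [flat=> ->|bd].
- by rewrite -!aid_tens acomp_idr //=; strict_ob.
Qed.

(** * Actions on the values of a right adjoint *)

Definition curry (C D : category) (G : functor C D) (R : functor D C)
    (ad : adjunction G R) (A : C) (B : D) (f : hom (G A) B) : hom A (R B) :=
  fmap R f ∘ adj_unit ad A.
Definition uncurry (C D : category) (G : functor C D) (R : functor D C)
    (ad : adjunction G R) (A : C) (B : D) (g : hom A (R B)) : hom (G A) B :=
  adj_counit ad B ∘ fmap G g.

Lemma curryK (C D : category) (G : functor C D) (R : functor D C)
  (ad : adjunction G R) (A : C) (B : D) (f : hom (G A) B) : uncurry ad (curry ad f) = f.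
Proof.
have /= h := ntc_nat (adj_counit ad) f.
by rewrite /uncurry /curry fmap_comp comp_assoc h -comp_assoc adj_triangle_l comp_idr.
Qed.

Lemma uncurryK (C D : category) (G : functor C D) (R : functor D C)
  (ad : adjunction G R) (A : C) (B : D) (g : hom A (R B)) : curry ad (uncurry ad g) = g.
Proof.
have /= h := ntc_nat (adj_unit ad) g.
by rewrite /uncurry /curry fmap_comp -comp_assoc -h comp_assoc adj_triangle_r comp_idl.
Qed.

Lemma uncurry_inj (C D : category) (G : functor C D) (R : functor D C)
  (ad : adjunction G R) (A : C) (B : D) (g g' : hom A (R B)) :
  uncurry ad g = uncurry ad g' -> g = g'.
Proof. by move=> e; rewrite -(uncurryK ad g) e uncurryK. Qed.

Lemma uncurry_comp (C D : category) (G : functor C D) (R : functor D C)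
  (ad : adjunction G R) (A A' : C) (B : D) (g : hom A (R B)) (f : hom A' A) :
  uncurry ad (g ∘ f) = uncurry ad g ∘ fmap G f.
Proof. by rewrite /uncurry fmap_comp comp_assoc. Qed.

(** The action whose components, after evaluation, first exchange F_i with G, then
    evaluate inside F_i, and then act on Y. *)
Definition hom_act (M : strict_monoidal) (P Q : M) (pp : pivotal_pair P Q)
    (G R : functor M M) (ad : adjunction G R) (L : action_law pp G) (Y : M)
    (act : forall i, hom (Fsign P Q i Y) Y) (i : sign) : hom (Fsign P Q i (R Y)) (R Y) :=
  curry ad (act i ∘ fmap (Fsign P Q i) (adj_counit ad Y) ∘ al_swap L i (R Y)).

Lemma uncurry_hom_act (M : strict_monoidal) (P Q : M) (pp : pivotal_pair P Q)
  (G R : functor M M) (ad : adjunction G R) (L : action_law pp G) (Y Z : M)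
  (act : forall i, hom (Fsign P Q i Y) Y) (i : sign) (g : hom Z (R Y)) :
  uncurry ad (hom_act ad L act i ∘ fmap (Fsign P Q i) g) =
  act i ∘ fmap (Fsign P Q i) (uncurry ad g) ∘ al_swap L i Z.
Proof.
rewrite uncurry_comp /hom_act curryK -!comp_assoc al_swap_nat.
by rewrite /uncurry fmap_comp -!comp_assoc.
Qed.

(** After transposition, the double action on R Y becomes the double action on Y with
    the two exchanges in front; the law moves these past the expansion, so the equation
    for Y applies, and naturality of the contraction brings it back to R Y. *)
Lemma hom_act_action (M : strict_monoidal) (P Q : M) (pp : pivotal_pair P Q)
  (G R : functor M M) (ad : adjunction G R) (L : action_law pp G) (Y : M)
  (act : forall i, hom (Fsign P Q i Y) Y) :
  is_action pp act -> is_action pp (hom_act ad L act).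
Proof.
move=> actP k; apply: (@uncurry_inj _ _ _ _ ad).
rewrite uncurry_comp uncurry_hom_act.
set e := adj_counit ad Y.
have -> : uncurry ad (hom_act ad L act (rel_inner k)) =
    act (rel_inner k) ∘ fmap (Fsign P Q (rel_inner k)) e ∘ al_swap L (rel_inner k) (R Y).
  exact: curryK.
have ex := al_expand L k (R Y); rewrite -!comp_assoc in ex.
rewrite !fmap_comp -!comp_assoc ex.
rewrite (comp_assoc (fmap _ (fmap _ e))) -rel_expand_nat.
rewrite !comp_assoc actP rel_contract_nat.
by rewrite /uncurry (al_contract L) comp_assoc.
Qed.

(** The action a' on G Z is the one induced by a along the exchange, which is
    invertible; so testing f on a' and testing its transpose on a is the same. *)
Lemma curry_hom (M : strict_monoidal) (P Q : M) (pp : pivotal_pair P Q)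
  (G R : functor M M) (ad : adjunction G R) (L : action_law pp G) (Y Z : M)
  (act : forall i, hom (Fsign P Q i Y) Y) (a : hom (Fsign P Q plus Z) Z)
  (a' : hom (Fsign P Q plus (G Z)) (G Z)) (f : hom (G Z) Y) :
  is_iso (al_swap L plus Z) -> a' ∘ al_swap L plus Z = fmap G a ->
  f ∘ a' = act plus ∘ fmap (Fsign P Q plus) f <->
  curry ad f ∘ a = hom_act ad L act plus ∘ fmap (Fsign P Q plus) (curry ad f).
Proof.
move=> [g [_ hg]] ea.
have e1 : uncurry ad (curry ad f ∘ a) = f ∘ a' ∘ al_swap L plus Z.
  by rewrite uncurry_comp curryK -comp_assoc ea.
have e2 := uncurry_hom_act ad L act plus (curry ad f).
rewrite curryK in e2; split=> [e|e].
  by apply: (@uncurry_inj _ _ _ _ ad); rewrite e1 e2 e.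
have := f_equal (fun u => uncurry ad u ∘ g) e.
by rewrite e1 e2 -!comp_assoc hg !comp_idr.
Qed.

Lemma sig_hom (M : strict_monoidal) (P Q : M) (pp : pivotal_pair P Q) (X Y : M)
  (f : hom X Y) (s : hom (X ⊗ P) (P ⊗ X)) (s' : hom (Y ⊗ P) (P ⊗ Y)) :
  s' ∘ (f ▷ P) = (P ◁ f) ∘ s <->
  f ∘ sig_act pp s = sig_act pp s' ∘ fmap (Fsign P Q plus) f.
Proof. by rewrite -(act_sig_hom pp) !sig_actK. Qed.

(** The half braiding of Z ⊗ X passes P first through X and then through Z. The exchange
    undoes the passage through X. *)
Lemma swap_r_tens (M : strict_monoidal) (P Q : M) (pp : pivotal_pair P Q) (X Z : M)
  (s : hom (X ⊗ P) (P ⊗ X)) (t : hom (P ⊗ X) (X ⊗ P)) (m : hom (Q ⊗ X) (X ⊗ Q))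
  (s' : hom (Z ⊗ P) (P ⊗ Z)) : s ∘ t = idm (P ⊗ X) ->
  sig_act pp (pq_tens_sig s' s) ∘ swap_r t m plus Z = sig_act pp s' ▷ X.
Proof.
move=> st; apply: arrow_inj; rewrite /swap_r tensm_arrow comp_arrow.
rewrite !sig_actE /luncurry pq_tens_sig_arrow ccast_arrow tensm_arrow.
have {}st : acomp (Arrow s) (Arrow t) = aid (P ⊗ X) by rewrite -comp_arrow st.
rewrite -acompA; [|bd|bd].
rewrite (@aid_acomp _ Q); [|bd].
rewrite -acompA; [|bd|bd].
have := f_equal (atens (aid (Q ⊗ Z))) st.
rewrite aid_acomp; [|bd].
rewrite aidE; flat => ->.
rewrite [in RHS]acomp_aid; [|bd].
by flat; rewrite -!aid_tens acomp_idr //=; strict_ob.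
Qed.

(** Here P passes through X last, just before it meets Q. Sliding the cap back across X
    cancels that passage. *)
Lemma swap_l_tens (M : strict_monoidal) (P Q : M) (pp : pivotal_pair P Q) (X Z : M)
  (s : hom (X ⊗ P) (P ⊗ X)) (n : hom (X ⊗ Q) (Q ⊗ X)) (s' : hom (Z ⊗ P) (P ⊗ Z)) :
  acomp (atens (Arrow (ev pp)) (aid X))
    (acomp (atens (aid Q) (Arrow s)) (atens (Arrow n) (aid P))) =
    atens (aid X) (Arrow (ev pp)) ->
  sig_act pp (pq_tens_sig s s') ∘ swap_l s n plus Z = X ◁ sig_act pp s'.
Proof.
move=> cap; apply: arrow_inj; rewrite /swap_l tensm_arrow comp_arrow.
rewrite !sig_actE /luncurry pq_tens_sig_arrow ccast_arrow tensm_arrow.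
rewrite -acompA; [|bd|bd].
rewrite (@aid_acomp _ Q); [|bd].
rewrite -acompA; [|bd|bd].
have := exchange (Arrow n) (Arrow s'); rewrite /= aidE; flat=> <-.
rewrite [in RHS]aid_acomp; [|bd].
have := f_equal (fun g => atens g (aid Z)) cap.
rewrite acomp_aid; [|bd]; rewrite acomp_aid; [|bd]; flat=> <-.
by rewrite -!acompA; try bd; flat.
Qed.

Lemma tens_r_law (M : strict_monoidal) (P Q : M) (pp : pivotal_pair P Q) (X : pq_ob pp) :
  exists L : action_law pp (tens_r (pq_carrier X)),
    (forall H, is_iso (al_swap L plus H)) /\
    forall Z (s : hom (Z ⊗ P) (P ⊗ Z)),
      sig_act pp (pq_tens_sig s (pq_sig X)) ∘ al_swap L plus Z =
      fmap (tens_r (pq_carrier X)) (sig_act pp s).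
Proof.
have [act [actP es]] := pq_cond_action (pq_ok X).
have [st_inv mn_inv] := proj1 (is_actionP _ _) actP.
have [/inverse_pair_arrow [ts st] /inverse_pair_arrow [nm mn]] := conj st_inv mn_inv.
have [sn sn'] := pivotal_snake pp.
have := (cup_pass_r (h := coev pp) (h' := ucoev pp) (a := act plus) (b := act minus)).
have := (cup_pass_r (h := ucoev pp) (h' := coev pp) (a := act minus) (b := act plus)).
have := (cap_pass_r (h := coev pp) (h' := ucoev pp) (a := act plus) (b := act minus) sn).
have := (cap_pass_r (h := ucoev pp) (h' := coev pp) (a := act minus) (b := act plus) sn').
rewrite -mate_act_sig -comate_act_sig_inv -act_sigE -act_sig_invE.
move=> /(_ nm) c1 /(_ st) c2 /(_ mn) c3 /(_ ts) c4.
exists (@ActionLaw _ _ _ pp (tens_r (pq_carrier X))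
  (swap_r (act_sig_inv pp (act minus)) (mate pp (act_sig pp (act plus))))
  (swap_r_nat _ _)
  (swap_src_r (act_sig_inv pp (act minus)) (mate pp (act_sig pp (act plus))))
  (fun k H => swap_r_expand k H c4 c3)
  (fun k H => swap_r_contract k H c2 c1)); split=> [H|Z s] /=; last first.
  rewrite -es.
  by apply: (@swap_r_tens _ _ _ _ _ _ _ _ (mate pp (act_sig pp (act plus)))); case: st_inv.
exists (⌈ (Q ⊗ H) ◁ act_sig pp (act plus) ⌉ :
  hom (Q ⊗ (H ⊗ pq_carrier X) ⊗ P) (Q ⊗ H ⊗ P ⊗ pq_carrier X)).
apply/inverse_pair_arrow; rewrite !ccast_arrow !tensm_arrow !aidE.
rewrite -!aid_acomp // ts st.
by flat.
Qed.

Lemma tens_l_law (M : strict_monoidal) (P Q : M) (pp : pivotal_pair P Q) (X : pq_ob pp) :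
  exists L : action_law pp (tens_l (pq_carrier X)),
    (forall H, is_iso (al_swap L plus H)) /\
    forall Z (s : hom (Z ⊗ P) (P ⊗ Z)),
      sig_act pp (pq_tens_sig (pq_sig X) s) ∘ al_swap L plus Z =
      fmap (tens_l (pq_carrier X)) (sig_act pp s).
Proof.
have [act [actP es]] := pq_cond_action (pq_ok X).
have [st_inv mn_inv] := proj1 (is_actionP _ _) actP.
have [/inverse_pair_arrow [ts st] /inverse_pair_arrow [nm mn]] := conj st_inv mn_inv.
have [sn sn'] := pivotal_snake pp.
have := (cup_pass_l (h := coev pp) (h' := ucoev pp) (a := act plus) (b := act minus)).
have := (cup_pass_l (h := ucoev pp) (h' := coev pp) (a := act minus) (b := act plus)).
have := (cap_pass_l (h := coev pp) (h' := ucoev pp) (a := act plus) (b := act minus) sn).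
have := (cap_pass_l (h := ucoev pp) (h' := coev pp) (a := act minus) (b := act plus) sn').
rewrite -mate_act_sig -comate_act_sig_inv -act_sigE -act_sig_invE.
move=> /(_ ts) c1 /(_ mn) c2 /(_ st) c3 /(_ nm) c4.
exists (@ActionLaw _ _ _ pp (tens_l (pq_carrier X))
  (swap_l (act_sig pp (act plus)) (comate pp (act_sig_inv pp (act minus))))
  (swap_l_nat _ _)
  (swap_src_l (act_sig pp (act plus)) (comate pp (act_sig_inv pp (act minus))))
  (fun k H => swap_l_expand k H c4 c3)
  (fun k H => swap_l_contract k H c2 c1)); split=> [H|Z s] /=; last first.
  by rewrite -es; apply: swap_l_tens.
exists (⌈ mate pp (act_sig pp (act plus)) ▷ (H ⊗ P) ⌉ :
  hom (Q ⊗ (pq_carrier X ⊗ H) ⊗ P) (pq_carrier X ⊗ (Q ⊗ H ⊗ P))).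
apply/inverse_pair_arrow; rewrite !ccast_arrow !tensm_arrow !aidE.
rewrite -!acomp_aid // nm mn.
by flat.
Qed.

(** W stands for the half braiding of the tensor product of a variable object with a
    fixed one, on either side. *)
Lemma hom_lift (M : strict_monoidal) (P Q : M) (pp : pivotal_pair P Q)
  (G R : functor M M) (ad : adjunction G R) (L : action_law pp G)
  (W : forall Z : M, hom (Z ⊗ P) (P ⊗ Z) -> hom (G Z ⊗ P) (P ⊗ G Z)) (Y : pq_ob pp) :
  (forall Z, is_iso (al_swap L plus Z)) ->
  (forall Z s, sig_act pp (W Z s) ∘ al_swap L plus Z = fmap G (sig_act pp s)) ->
  exists s' : hom (R (pq_carrier Y) ⊗ P) (P ⊗ R (pq_carrier Y)), pq_cond pp s' /\
  forall (Z : M) (s : hom (Z ⊗ P) (P ⊗ Z)) (f : hom (G Z) (pq_carrier Y)),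
    pq_sig Y ∘ (f ▷ P) = (P ◁ f) ∘ W Z s <->
    s' ∘ (curry ad f ▷ P) = (P ◁ curry ad f) ∘ s.
Proof.
move=> isoL compL; have [act [actP es]] := pq_cond_action (pq_ok Y).
exists (act_sig pp (hom_act ad L act plus)); split=> [|Z s f].
  exact: (action_pq_cond (hom_act_action ad L actP)).
rewrite !(sig_hom pp) -es !act_sigK.
exact: curry_hom.
Qed.

(** * Couniversal arrows and internal homs of C(P,Q) *)

Definition couniversal (C D : category) (G : functor C D) (B : D) (R : C)
    (e : hom (G R) B) : Prop :=
  forall (A : C) (f : hom (G A) B), exists! g : hom A R, e ∘ fmap G g = f.
Arguments couniversal {C D} G {B R} e.

Lemma couniversal_inj (C D : category) (G : functor C D) (B : D) (R : C)
  (e : hom (G R) B) (A : C) (g g' : hom A R) :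
  couniversal G e -> e ∘ fmap G g = e ∘ fmap G g' -> g = g'.
Proof. by move=> he eq; have [u [_ hu]] := he A (e ∘ fmap G g'); rewrite -(hu g eq) (hu g'). Qed.

Lemma counit_couniversal (C D : category) (G : functor C D) (R : functor D C)
  (ad : adjunction G R) (B : D) : couniversal G (adj_counit ad B).
Proof.
move=> A f; exists (curry ad f); split=> [|g <-]; first exact: (curryK ad f).
exact: (uncurryK ad g).
Qed.

(** Two arrows couniversal from G to B factor through each other. *)
Lemma couniversal_iso (C D : category) (G : functor C D) (B : D) (R R' : C)
  (e : hom (G R) B) (e' : hom (G R') B) : couniversal G e -> couniversal G e' ->
  exists c : hom R R', e' ∘ fmap G c = e /\ is_iso c.
Proof.
move=> he he'; have [c [ec _]] := he' R e; have [d [ed _]] := he R' e'.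
exists c; split=> //; exists d; split.
  by apply: (couniversal_inj he); rewrite fmap_comp comp_assoc ed ec fmap_id comp_idr.
by apply: (couniversal_inj he'); rewrite fmap_comp comp_assoc ec ed fmap_id comp_idr.
Qed.

Lemma couniversal_adjoint (C D : category) (G : functor C D) :
  (forall B : D, exists (R : C) (e : hom (G R) B), couniversal G e) ->
  exists R : functor D C, inhabited (adjunction G R).
Proof.
move=> h.
have R B : {r : C & {e : hom (G r) B | couniversal G e}}.
  have [r] := constructive_indefinite_description _ (h B).
  by move=> /constructive_indefinite_description; exists r.
pose r B := projT1 (R B); pose e B : hom (G (r B)) B := proj1_sig (projT2 (R B)).
have he B : couniversal G (e B) := proj2_sig (projT2 (R B)).
have lift A B (f : hom (G A) B) : {g : hom A (r B) | e B ∘ fmap G g = f}.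
  by apply: constructive_indefinite_description; have [g [hg _]] := he B A f; exists g.
pose m A B (f : hom A B) := proj1_sig (lift _ _ (f ∘ e A)).
have em A B (f : hom A B) : e B ∘ fmap G (m A B f) = f ∘ e A := proj2_sig (lift _ _ _).
have mid A : m A A (idm A) = idm (r A).
  by apply: (couniversal_inj (he A)); rewrite em fmap_id comp_idl comp_idr.
have mcomp A B E (g : hom B E) (f : hom A B) : m A E (g ∘ f) = m B E g ∘ m A B f.
  apply: (couniversal_inj (he E)).
  by rewrite em fmap_comp comp_assoc em -!comp_assoc em.
pose RF := @Functor D C r m mid mcomp.
pose u A := proj1_sig (lift A (G A) (idm (G A))).
have eu A : e (G A) ∘ fmap G (u A) = idm (G A) := proj2_sig (lift _ _ _).
have unat A B (f : hom A B) : u B ∘ f = m _ _ (fmap G f) ∘ u A.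
  apply: (couniversal_inj (he (G B))).
  by rewrite !fmap_comp !comp_assoc em eu -comp_assoc eu comp_idl comp_idr.
exists RF; constructor.
apply: (@Adjunction C D G RF (@NatTrans C C (fid C) (fcomp RF G) u unat)
  (@NatTrans D D (fcomp G RF) (fid D) e em)) => [A|B] /=; first exact: eu.
apply: (couniversal_inj (he B)).
by rewrite fmap_comp comp_assoc em -comp_assoc eu fmap_id.
Qed.

Lemma curry_counit (C D : category) (G : functor C D) (R : functor D C)
  (ad : adjunction G R) (B : D) : curry ad (adj_counit ad B) = idm (R B).
Proof. exact: adj_triangle_r. Qed.

(** The internal hom of C carries the structure of an object of C(P,Q) for which the
    evaluation of C itself is a couniversal arrow. Keeping the same evaluation is what
    identifies the comparison morphism below. *)
Lemma pq_lhom (M : strict_monoidal) (P Q : M) (pp : pivotal_pair P Q)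
  (X Y : pq_monoidal pp) (R : functor M M) (ad : adjunction (tens_r (pq_carrier X)) R) :
  exists (s : hom (R (pq_carrier Y) ⊗ P) (P ⊗ R (pq_carrier Y))) (ok : pq_cond pp s)
    (e : hom (tens_r X (PQOb ok : pq_monoidal pp)) Y),
    couniversal (tens_r X) e /\ pq_map e = adj_counit ad (pq_carrier Y).
Proof.
have [L [isoL compL]] := tens_r_law X.
have [s [ok hs]] := hom_lift ad (W := fun Z s => pq_tens_sig s (pq_sig X)) Y isoL compL.
have comm : pq_sig Y ∘ (adj_counit ad (pq_carrier Y) ▷ P) =
    (P ◁ adj_counit ad (pq_carrier Y)) ∘ pq_sig (pq_tens (PQOb ok) X).
  by apply/hs; rewrite curry_counit !tensm_id comp_idl comp_idr.
exists s, ok, (@PQHom _ _ _ _ (pq_tens (PQOb ok) X) Y (adj_counit ad (pq_carrier Y)) comm).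
split=> // Z f.
exists (@PQHom _ _ _ _ Z (PQOb ok) (curry ad (pq_map f)) (proj1 (hs _ _ _) (pq_comm f))).
split=> [|g eg]; apply: pq_hom_ext; first exact: (curryK ad (pq_map f)).
by rewrite -eg; exact: (uncurryK ad (pq_map g)).
Qed.

Lemma pq_rhom (M : strict_monoidal) (P Q : M) (pp : pivotal_pair P Q)
  (X Y : pq_monoidal pp) (R : functor M M) (ad : adjunction (tens_l (pq_carrier X)) R) :
  exists (s : hom (R (pq_carrier Y) ⊗ P) (P ⊗ R (pq_carrier Y))) (ok : pq_cond pp s)
    (e : hom (tens_l X (PQOb ok : pq_monoidal pp)) Y),
    couniversal (tens_l X) e /\ pq_map e = adj_counit ad (pq_carrier Y).
Proof.
have [L [isoL compL]] := tens_l_law X.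
have [s [ok hs]] := hom_lift ad (W := fun Z s => pq_tens_sig (pq_sig X) s) Y isoL compL.
have comm : pq_sig Y ∘ (adj_counit ad (pq_carrier Y) ▷ P) =
    (P ◁ adj_counit ad (pq_carrier Y)) ∘ pq_sig (pq_tens X (PQOb ok)).
  by apply/hs; rewrite curry_counit !tensm_id comp_idl comp_idr.
exists s, ok, (@PQHom _ _ _ _ (pq_tens X (PQOb ok)) Y (adj_counit ad (pq_carrier Y)) comm).
split=> // Z f.
exists (@PQHom _ _ _ _ Z (PQOb ok) (curry ad (pq_map f)) (proj1 (hs _ _ _) (pq_comm f))).
split=> [|g eg]; apply: pq_hom_ext; first exact: (curryK ad (pq_map f)).
by rewrite -eg; exact: (uncurryK ad (pq_map g)).
Qed.

Lemma closed_of_adjoints (M : strict_monoidal) :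
  (forall A : M, exists R, inhabited (adjunction (tens_r A) R)) ->
  (forall A : M, exists R, inhabited (adjunction (tens_l A) R)) -> inhabited (closed M).
Proof.
move=> hr hl; constructor.
have pick (G : functor M M) : (exists R, inhabited (adjunction G R)) ->
    {R : functor M M & adjunction G R}.
  move=> /constructive_indefinite_description [R h]; exists R.
  by apply: (epsilon h (fun _ => True)).
pose l A := pick _ (hr A); pose r A := pick _ (hl A).
exact: (Closed (fun A => projT2 (l A)) (fun A => projT2 (r A))).
Qed.

Lemma pq_closed (M : strict_monoidal) (P Q : M) (pp : pivotal_pair P Q) :
  closed M -> inhabited (closed (pq_monoidal pp)).
Proof.
move=> K; apply: closed_of_adjoints => X; apply: couniversal_adjoint => Y.
  have [s [ok [e [he _]]]] := pq_lhom Y (lhom_adj K (pq_carrier X)).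
  by exists (PQOb ok), e.
have [s [ok [e [he _]]]] := pq_rhom Y (rhom_adj K (pq_carrier X)).
by exists (PQOb ok), e.
Qed.

Lemma pq_map_iso (M : strict_monoidal) (P Q : M) (pp : pivotal_pair P Q)
  (X Y : pq_monoidal pp) (f : hom X Y) : is_iso f -> is_iso (pq_map f).
Proof.
move=> [g [/(f_equal (@pq_map _ _ _ _ _ _)) e1 /(f_equal (@pq_map _ _ _ _ _ _)) e2]].
by exists (pq_map g).
Qed.

(** The comparison is the underlying map of the unique factorization of the evaluation
    of KM through the couniversal arrow of [pq_lhom]. *)
Lemma forget_left_closed (M : strict_monoidal) (P Q : M) (pp : pivotal_pair P Q)
  (KM : closed (pq_monoidal pp)) (KN : closed M) (X Y : pq_monoidal pp) :
  is_iso (lhom_comparison KM KN (pq_forget_strong pp) X Y).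
Proof.
have [s [ok [e [he ee]]]] := pq_lhom Y (lhom_adj KN (pq_carrier X)).
have [c [ec /pq_map_iso ic]] :=
  couniversal_iso (counit_couniversal (lhom_adj KM X) (B := Y)) he.
suff -> : lhom_comparison KM KN (pq_forget_strong pp) X Y = pq_map c by [].
apply: (@uncurry_inj _ _ _ _ (lhom_adj KN (pq_carrier X))).
rewrite (curryK (lhom_adj KN (pq_carrier X))) /= comp_idr /uncurry -ee.
by rewrite -ec.
Qed.

Lemma forget_right_closed (M : strict_monoidal) (P Q : M) (pp : pivotal_pair P Q)
  (KM : closed (pq_monoidal pp)) (KN : closed M) (X Y : pq_monoidal pp) :
  is_iso (rhom_comparison KM KN (pq_forget_strong pp) X Y).
Proof.
have [s [ok [e [he ee]]]] := pq_rhom Y (rhom_adj KN (pq_carrier X)).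
have [c [ec /pq_map_iso ic]] :=
  couniversal_iso (counit_couniversal (rhom_adj KM X) (B := Y)) he.
suff -> : rhom_comparison KM KN (pq_forget_strong pp) X Y = pq_map c by [].
apply: (@uncurry_inj _ _ _ _ (rhom_adj KN (pq_carrier X))).
rewrite (curryK (rhom_adj KN (pq_carrier X))) /= comp_idr /uncurry -ee.
by rewrite -ec.
Qed.

(** * Pointwise colimits of functors *)

(** The coproduct of the X w followed by the colimit of parallel pairs, merged into a
    single universal property in terms of families of maps out of the X w. In this form
    it can be evaluated at an object of the domain of a functor category. *)
Definition is_quotient (C : category) (W K : Type) (X : W -> C) (Y : K -> C)
    (s t : K -> W) (f : forall k, hom (Y k) (X (s k))) (g : forall k, hom (Y k) (X (t k)))
    (L : C) (l : forall w, hom (X w) L) : Prop :=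
  (forall k, l (s k) ∘ f k = l (t k) ∘ g k) /\
  forall (Z : C) (h : forall w, hom (X w) Z),
    (forall k, h (s k) ∘ f k = h (t k) ∘ g k) -> exists! u : hom L Z, forall w, u ∘ l w = h w.

Definition jointly_epi (C : category) (W : Type) (X : W -> C) (L : C)
    (l : forall w, hom (X w) L) : Prop :=
  forall (Z : C) (u u' : hom L Z), (forall w, u ∘ l w = u' ∘ l w) -> u = u'.

Lemma quotient_epi (C : category) (W K : Type) (X : W -> C) (Y : K -> C)
  (s t : K -> W) (f : forall k, hom (Y k) (X (s k))) (g : forall k, hom (Y k) (X (t k)))
  (L : C) (l : forall w, hom (X w) L) : is_quotient f g l -> jointly_epi l.
Proof.
move=> [rel univ] Z u u' e.
have [|v [_ hv]] := univ Z (fun w => u' ∘ l w).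
  by move=> k; rewrite -!comp_assoc rel.
by rewrite -(hv u e) (hv u').
Qed.

Lemma coproduct_pairs_quotient (C : category) (W K : Type) (X : W -> C) (Y : K -> C)
  (s t : K -> W) (f : forall k, hom (Y k) (X (s k))) (g : forall k, hom (Y k) (X (t k)))
  (S : C) (i : forall w, hom (X w) S) (L : C) (p : hom S L) :
  is_coproduct i ->
  is_colimit_of_pairs (fun k => i (s k) ∘ f k) (fun k => i (t k) ∘ g k) p ->
  is_quotient f g (fun w => p ∘ i w).
Proof.
move=> hi [coeq univ]; split=> [k|Z h eh].
  by have := coeq k; rewrite !comp_assoc.
have [h' [eh' uh']] := hi Z h.
have [|u [eu uu]] := univ Z h'.
  by move=> k; rewrite !comp_assoc !eh'.
exists u; split=> [w|v ev]; first by rewrite comp_assoc eu eh'.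
by apply: uu; rewrite -(uh' (v ∘ p)) // => w; rewrite -comp_assoc.
Qed.

Lemma countable_quotient (C : category) (W K : Type) (cW : W -> nat) (cK : K -> nat)
  (X : W -> C) (Y : K -> C)
  (s t : K -> W) (f : forall k, hom (Y k) (X (s k))) (g : forall k, hom (Y k) (X (t k))) :
  has_countable_colimits C -> (forall a b, cW a = cW b -> a = b) ->
  (forall a b, cK a = cK b -> a = b) ->
  exists (L : C) (l : forall w, hom (X w) L), is_quotient f g l.
Proof.
move=> hC iW iK.
have [S [i hi]] := countable_coproduct X hC iW.
have [L [p hp]] := countable_colimit_of_pairs
  (fun k => i (s k) ∘ f k) (fun k => i (t k) ∘ g k) hC iK.
by exists L, (fun w => p ∘ i w); apply: coproduct_pairs_quotient.
Qed.

(** The colimits N A chosen in D for each A form a functor with a cocone, so the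
    universal properties of L and of N A give maps L A → N A → L A, whose
    composite is the identity by uniqueness in the functor category. So L A is a retract
    of N A compatible with the cocones, which is enough for the universal property. *)
Lemma quotient_pointwise (C D : category) (W K : Type) (X : W -> functor C D)
  (Y : K -> functor C D) (s t : K -> W) (f : forall k, nat_trans (Y k) (X (s k)))
  (g : forall k, nat_trans (Y k) (X (t k))) (L : functor C D)
  (l : forall w, nat_trans (X w) L) :
  @is_quotient (functor_cat C D) W K X Y s t f g L l ->
  (forall A, exists (L' : D) (l' : forall w, hom (X w A) L'),
    is_quotient (fun k => f k A) (fun k => g k A) l') ->
  forall A, is_quotient (fun k => f k A) (fun k => g k A) (fun w => l w A).
Proof.
move=> ql ex.
have relA A k : l (s k) A ∘ f k A = l (t k) A ∘ g k A.
  exact: (f_equal (fun n : nat_trans _ _ => n A) (proj1 ql k)).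
have pick A : {L' : D & {l' : forall w, hom (X w A) L' |
    is_quotient (fun k => f k A) (fun k => g k A) l'}}.
  have [L'] := constructive_indefinite_description _ (ex A).
  by move=> /constructive_indefinite_description; exists L'.
pose N A := projT1 (pick A).
pose n A : forall w, hom (X w A) (N A) := proj1_sig (projT2 (pick A)).
have qn A : is_quotient (fun k => f k A) (fun k => g k A) (n A) := proj2_sig (projT2 (pick A)).
have epi A := quotient_epi (qn A).
have lift A Z (h : forall w, hom (X w A) Z) :
    (forall k, h (s k) ∘ f k A = h (t k) ∘ g k A) ->
    {u : hom (N A) Z | forall w, u ∘ n A w = h w}.
  move=> eh; apply: constructive_indefinite_description.
  by have [u [hu _]] := proj2 (qn A) Z h eh; exists u.
have m A B (a : hom A B) : {u : hom (N A) (N B) | forall w, u ∘ n A w = n B w ∘ fmap (X w) a}.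
  apply: lift => k; rewrite -!comp_assoc -!ntc_nat !comp_assoc.
  by rewrite (proj1 (qn B)).
have em A B a := proj2_sig (m A B a).
have mid A : proj1_sig (m A A (idm A)) = idm (N A).
  by apply: epi => w; rewrite em fmap_id comp_idl comp_idr.
have mcomp A B E (b : hom B E) (a : hom A B) :
    proj1_sig (m A E (b ∘ a)) = proj1_sig (m B E b) ∘ proj1_sig (m A B a).
  by apply: epi => w; rewrite em fmap_comp -[RHS]comp_assoc em !comp_assoc em.
pose NF := @Functor C D N (fun A B a => proj1_sig (m A B a)) mid mcomp.
pose nF w : nat_trans (X w) NF :=
  @NatTrans C D (X w) NF (fun A => n A w) (fun A B a => eq_sym (em A B a w)).
have [|h [eh _]] := proj2 ql NF nF.
  by move=> k; apply: nat_trans_ext => A; apply: (proj1 (qn A)).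
have ehA A w : (h : nat_trans L NF) A ∘ l w A = n A w.
  exact: (f_equal (fun z : nat_trans _ _ => z A) (eh w)).
have c A : {u : hom (N A) (L A) | forall w, u ∘ n A w = l w A} := lift _ _ _ (relA A).
have ec A := proj2_sig (c A).
have cnat A B (a : hom A B) : proj1_sig (c B) ∘ fmap NF a = fmap L a ∘ proj1_sig (c A).
  apply: epi => w; rewrite -!comp_assoc ec [fmap NF a]/= em comp_assoc ec.
  exact: ntc_nat.
have ch : nat_comp (@NatTrans C D NF L (fun A => proj1_sig (c A)) cnat) h = nat_id L.
  apply: (quotient_epi ql) => w; apply: nat_trans_ext => A /=.
  by rewrite -comp_assoc ehA ec comp_idl.
have chA A : proj1_sig (c A) ∘ (h : nat_trans L NF) A = idm (L A).
  exact: (f_equal (fun z : nat_trans _ _ => z A) ch).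
move=> A; split=> [k|Z z ez]; first exact: relA.
have [u [eu uu]] := proj2 (qn A) Z z ez.
exists (u ∘ (h : nat_trans L NF) A); split=> [w|v ev].
  by rewrite -comp_assoc ehA.
rewrite (uu (v ∘ proj1_sig (c A))) => [|w]; last by rewrite -comp_assoc ec.
by rewrite -comp_assoc chA comp_idr.
Qed.

(** * The free action T(X) *)

Lemma pair_index_code (V : word -> Prop) :
  exists code : pair_index V -> nat, forall a b, code a = code b -> a = b.
Proof.
have [code inj] := word_code.
pose kind k := match k with rel1 => 0 | rel2 => 1 | rel3 => 2 | rel4 => 3 end.
exists (fun r => Cantor.to_nat (code (proj1_sig (fst r)),
  Cantor.to_nat (kind (fst (snd r)), code (snd (snd r))))).
move=> [[v hv] [k w]] [[v' hv'] [k' w']] /Cantor.to_nat_inj e.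
have /inj /= ev := f_equal fst e.
have {}e := Cantor.to_nat_inj _ _ (f_equal snd e).
have /= ek := f_equal fst e; have /inj /= ew := f_equal snd e; subst v' w'.
rewrite (proof_irrelevance _ hv hv').
by case: k ek {e}; case: k'.
Qed.

Definition pair_lhs_word (V : word -> Prop) (r : pair_index V) : word :=
  proj1_sig (fst r) ++ rel_outer (fst (snd r)) :: rel_inner (fst (snd r)) :: snd (snd r).
Definition pair_rhs_word (V : word -> Prop) (r : pair_index V) : word :=
  proj1_sig (fst r) ++ snd (snd r).

Definition pair_expand (M : strict_monoidal) (P Q : M) (pp : pivotal_pair P Q)
    (V : word -> Prop) (r : pair_index V) :
    nat_trans (pair_source P Q r) (Fword P Q (pair_lhs_word r)) :=
  prefix (proj1_sig (fst r)) (rel_expand pp (snd r)).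
Definition pair_contract (M : strict_monoidal) (P Q : M) (pp : pivotal_pair P Q)
    (V : word -> Prop) (r : pair_index V) :
    nat_trans (pair_source P Q r) (Fword P Q (pair_rhs_word r)) :=
  prefix (proj1_sig (fst r)) (rel_contract pp (snd r)).

Lemma T_quotient (M : strict_monoidal) (P Q : M) (pp : pivotal_pair P Q)
  (V : word -> Prop) (T : T_construction pp V) :
  has_countable_colimits M -> forall X : M,
  is_quotient (fun r : pair_index V => pair_expand pp r X)
    (fun r => pair_contract pp r X) (fun w => psi_word T w X).
Proof.
move=> hM.
have [cW iW] := word_code; have [cK iK] := pair_index_code V.
have [coeq univ] := Tfun_colimit T.
apply: (quotient_pointwise (f := @pair_expand M P Q pp V) (g := @pair_contract M P Q pp V)).
  apply: (coproduct_pairs_quotient (C := functor_cat M M) (Fstar_coproduct T)).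
  split=> [[[v hv] [k w]]|Z h eh]; first exact: (coeq (exist V v hv, (k, w))).
  by apply: univ => -[[v hv] [k w]]; apply: (eh (exist V v hv, (k, w))).
by move=> A; apply: countable_quotient hM iW iK.
Qed.

Lemma left_adjoint_epi (C D : category) (G : functor C D) (R : functor D C)
  (ad : adjunction G R) (W : Type) (X : W -> C) (L : C) (l : forall w, hom (X w) L) :
  jointly_epi l -> jointly_epi (fun w => fmap G (l w)).
Proof.
move=> epi Z u u' e.
have cc v w : curry ad v ∘ l w = curry ad (v ∘ fmap G (l w)).
  have /= h := ntc_nat (adj_unit ad) (l w).
  by rewrite /curry fmap_comp -!comp_assoc h.
rewrite -(curryK ad u) -(curryK ad u'); congr uncurry.
by apply: epi => w; rewrite !cc e.
Qed.

Lemma Fsign_epi (M : strict_monoidal) (P Q : M) (i : sign) (W : Type) (X : W -> M)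
  (L : M) (l : forall w, hom (X w) L) : closed M ->
  jointly_epi l -> jointly_epi (fun w => fmap (Fsign P Q i) (l w)).
Proof.
move=> K epi; case: i.
  exact: (left_adjoint_epi (lhom_adj K P) (left_adjoint_epi (rhom_adj K Q) epi)).
exact: (left_adjoint_epi (lhom_adj K Q) (left_adjoint_epi (rhom_adj K P) epi)).
Qed.

Lemma rel_src_epi (M : strict_monoidal) (P Q : M) (k : rel_kind) (W : Type) (X : W -> M)
  (L : M) (l : forall w, hom (X w) L) : closed M ->
  jointly_epi l -> jointly_epi (fun w => fmap (rel_src P Q k) (l w)).
Proof.
move=> K epi; case: k.
- exact: (left_adjoint_epi (rhom_adj K _) epi).
- exact: (left_adjoint_epi (lhom_adj K _) epi).
- exact: (left_adjoint_epi (rhom_adj K _) epi).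
- exact: (left_adjoint_epi (lhom_adj K _) epi).
Qed.

Lemma induced_at (M : strict_monoidal) (P Q : M) (pp : pivotal_pair P Q)
  (V : word -> Prop) (T : T_construction pp V) (i : sign)
  (a : nat_trans (fcomp (Fsign P Q i) (Tfun T)) (Tfun T)) (X : M) (w : word) :
  is_induced i a -> a X ∘ fmap (Fsign P Q i) (psi_word T w X) = psi_word T (i :: w) X.
Proof. by move=> h; exact: (f_equal (fun n : nat_trans _ _ => n X) (h w)). Qed.

(** On the image of F_w the four equations are the relations that the colimit imposes,
    and these images are jointly epic even after applying the source of the relations. *)
Lemma T_action (M : strict_monoidal) (P Q : M) (pp : pivotal_pair P Q)
  (V : word -> Prop) (T : T_construction pp V) (X : M)
  (act : forall i, hom (Fsign P Q i (Tfun T X)) (Tfun T X)) :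
  closed M -> has_countable_colimits M -> V [] ->
  (forall i w, act i ∘ fmap (Fsign P Q i) (psi_word T w X) = psi_word T (i :: w) X) ->
  is_action pp act.
Proof.
move=> K hM V0 ha k.
apply: (rel_src_epi K (quotient_epi (T_quotient T hM X))) => w.
rewrite -comp_assoc rel_expand_nat rel_contract_nat !comp_assoc.
rewrite -(comp_assoc (act _)) -fmap_comp ha.
rewrite [X in X ∘ _](ha (rel_outer k) (rel_inner k :: w)).
exact: (proj1 (T_quotient T hM X) (exist V [] V0, (k, w))).
Qed.

(** The only possible value on F_w of an extension of f to a morphism of actions. *)
Fixpoint extend (M : strict_monoidal) (P Q X Y : M)
    (act : forall i, hom (Fsign P Q i Y) Y) (f : hom X Y) (w : word) :
    hom (Fword P Q w X) Y :=
  match w return hom (Fword P Q w X) Y with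
  | [] => f
  | i :: w' => act i ∘ fmap (Fsign P Q i) (extend act f w')
  end.

(** For an empty prefix this is the equation of the action on Y, transported along the
    naturality of both members of the pair; a letter of the prefix just applies F_i. *)
Lemma extend_coequalizes (M : strict_monoidal) (P Q : M) (pp : pivotal_pair P Q)
  (X Y : M) (act : forall i, hom (Fsign P Q i Y) Y) (f : hom X Y)
  (V : word -> Prop) (r : pair_index V) : is_action pp act ->
  extend act f (pair_lhs_word r) ∘ pair_expand pp r X =
  extend act f (pair_rhs_word r) ∘ pair_contract pp r X.
Proof.
move=> actP; case: r => [[v hv] [k w]].
suff: extend act f (v ++ rel_outer k :: rel_inner k :: w) ∘ prefix v (rel_expand pp (k, w)) X =
    extend act f (v ++ w) ∘ prefix v (rel_contract pp (k, w)) X by [].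
elim: v {hv} => [|i v IH] /=; last by rewrite -!comp_assoc -!fmap_comp IH.
have en := rel_expand_nat pp k (extend act f w).
have cn := rel_contract_nat pp k (extend act f w).
rewrite -cn -(actP k) fmap_comp -!comp_assoc -en.
by rewrite !comp_assoc.
Qed.

(** On words a morphism of actions is forced by its value on the empty word, whence
    uniqueness. Conversely, that the extension commutes with the actions is tested on
    the images of F_i applied to the words, which are jointly epic. *)
Lemma T_extend (M : strict_monoidal) (P Q : M) (pp : pivotal_pair P Q)
  (V : word -> Prop) (T : T_construction pp V) (X Y : M)
  (act : forall i, hom (Fsign P Q i (Tfun T X)) (Tfun T X))
  (act' : forall i, hom (Fsign P Q i Y) Y) (f : hom X Y) :
  closed M -> has_countable_colimits M ->
  (forall i w, act i ∘ fmap (Fsign P Q i) (psi_word T w X) = psi_word T (i :: w) X) ->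
  is_action pp act' ->
  exists! h : hom (Tfun T X) Y,
    (forall i, h ∘ act i = act' i ∘ fmap (Fsign P Q i) h) /\ h ∘ psi_word T [] X = f.
Proof.
move=> K hM ha actP.
have [|h [eh uh]] := proj2 (T_quotient T hM X) Y (extend act' f).
  by move=> r; apply: extend_coequalizes.
exists h; split=> [|h' [h1 h2]].
  split; last exact: (eh []).
  move=> i; apply: (@Fsign_epi M P Q i _ _ _ _ K (quotient_epi (T_quotient T hM X))) => w.
  by rewrite -!comp_assoc ha -fmap_comp eh (eh (i :: w)).
apply: uh; elim=> [|i w IH]; first exact: h2.
suff: h' ∘ (act i ∘ fmap (Fsign P Q i) (psi_word T w X)) =
    act' i ∘ fmap (Fsign P Q i) (extend act' f w) by rewrite ha.
by rewrite comp_assoc h1 -comp_assoc -fmap_comp IH.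
Qed.

(** * The Hopf adjunction *)

Lemma adjunction_of_universal (C D : category) (F : functor C D) (G : functor D C)
  (u : nat_trans (fid C) (fcomp G F)) :
  (forall (A : C) (B : D) (f : hom A (G B)), exists! h : hom (F A) B, fmap G h ∘ u A = f) ->
  inhabited (adjunction F G).
Proof.
move=> univ.
have inj A B (h h' : hom (F A) B) : fmap G h ∘ u A = fmap G h' ∘ u A -> h = h'.
  by move=> e; have [k [_ hk]] := univ A B (fmap G h' ∘ u A); rewrite -(hk h e) (hk h').
have c B : {h : hom (F (G B)) B | fmap G h ∘ u (G B) = idm (G B)}.
  apply: constructive_indefinite_description.
  by have [h [eh _]] := univ (G B) B (idm (G B)); exists h.
have ec B := proj2_sig (c B).
have un A A' (f : hom A A') : u A' ∘ f = fmap G (fmap F f) ∘ u A := ntc_nat u f.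
have cnat A B (f : hom A B) : proj1_sig (c B) ∘ fmap F (fmap G f) = f ∘ proj1_sig (c A).
  by apply: inj; rewrite !fmap_comp -!comp_assoc -un ec comp_assoc ec comp_idl comp_idr.
constructor; apply: (@Adjunction C D F G u
  (@NatTrans D D (fcomp F G) (fid D) (fun B => proj1_sig (c B)) cnat)) => [A|B] /=; last exact: ec.
by apply: inj; rewrite fmap_comp -comp_assoc -un comp_assoc ec comp_idl fmap_id comp_idl.
Qed.

Theorem theorem5p2 (M : strict_monoidal) (M_closed : inhabited (closed M))
    (M_colimits : has_countable_colimits M)
    (P Q : M) (pp : pivotal_pair P Q)
    (V : word -> Prop) (V_nil : V nil) (T : T_construction pp V)
    (alpha : nat_trans (fcomp (Fsign P Q plus) (Tfun T)) (Tfun T))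
    (beta : nat_trans (fcomp (Fsign P Q minus) (Tfun T)) (Tfun T))
    (alpha_spec : is_induced plus alpha) (beta_spec : is_induced minus beta) :
  exists H : forall X : M, pq_cond pp (sigma_T alpha X),
    hopf_adjunction (free_functor H) (pq_forget_strong pp).
Proof.
case: M_closed => K.
pose act X i : hom (Fsign P Q i (Tfun T X)) (Tfun T X) :=
  match i return hom (Fsign P Q i (Tfun T X)) (Tfun T X) with
  | plus => alpha X | minus => beta X end.
have ha X i w : act X i ∘ fmap (Fsign P Q i) (psi_word T w X) = psi_word T (i :: w) X.
  by case: i; apply: induced_at.
have actP X : is_action pp (act X) by apply: T_action.
have es X : act_sig pp (act X plus) = sigma_T alpha X by [].
have H X : pq_cond pp (sigma_T alpha X) by rewrite -es; apply: action_pq_cond.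
exists H; constructor.
- pose u : nat_trans (fid M) (fcomp (pq_forget pp) (free_functor H)) :=
    @NatTrans _ _ (fid M) (fcomp (pq_forget pp) (free_functor H))
      (fun X => psi_word T [] X) (ntc_nat (psi_word T [])).
  apply: (adjunction_of_universal (u := u)) => X Y f.
  have [act' [actP' es']] := pq_cond_action (pq_ok Y).
  have [h [[h1 h2] uh]] := T_extend f K M_colimits (ha X) actP'.
  have hc : pq_sig Y ∘ (h ▷ P) = (P ◁ h) ∘ sigma_T alpha X.
    by rewrite -es' -es; apply/act_sig_hom/h1.
  exists (@PQHom _ _ _ _ (PQOb (H X)) Y h hc); split=> // g eg.
  apply: pq_hom_ext; apply: uh; split=> //.
  apply: (action_hom (actP X) actP'); apply/(act_sig_hom pp).
  rewrite es'; exact: (pq_comm g).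
- by constructor.
- exact: pq_closed.
- exact: forget_left_closed.
- exact: forget_right_closed.
Qed.
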